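(* Let $N\ge 2$ be an integer and let $\mathbb{A}=\{(y_j)_{j=1}^N\in(\mathbb{R}^3)^N : y_j\ne y_{j'}\text{ for } j\neq j'\}$, regarded as a metric space with the distance induced by the norm $|y|_2=(\sum_{j=1}^N|y_j|^2)^{1/2}$. Then there exists a subset $\mathbb{A}_1\subset\mathbb{A}$ that is open and dense in the metric space $\mathbb{A}$ and such that, for every $Y\in\mathbb{A}_1$ and every $a\in\mathbb{C}^N$, the resonance counting function of the point interaction Hamiltonian $H_{a,Y}$ satisfies $$\mathcal{N}_{H_{a,Y}}(R)=\frac{V(Y)}{\pi}R+O(1)\quad\text{as } R\to\infty .$$
   Context: For $Y=(y_j)_{j=1}^N\in\mathbb{A}$ (the centers) and $a=(a_j)_{j=1}^N\in\mathbb{C}^N$ (the strength parameters), $H_{a,Y}$ denotes the Schrödinger Hamiltonian in $L^2(\mathbb{R}^3)$ with point interactions at the centers $y_j$. It is the closed operator whose resolvent $(H_{a,Y}-z^2)^{-1}$ (for $z$ with $\operatorname{Im} z>0$ and $z^2$ outside the spectrum) has integral kernel $$G_z(x-x')+\sum_{j,j'=1}^N G_z(x-y_j)\,[\Gamma_{a,Y}(z)^{-1}]_{j,j'}\,G_z(x'-y_{j'}),\qquad G_z(x)=\frac{e^{\mathrm{i}z|x|}}{4\pi|x|},$$ where $\Gamma_{a,Y}(z)$ is the $N\times N$ matrix $$\Gamma_{a,Y}(z)=\Big[\big(a_j-\tfrac{\mathrm{i}z}{4\pi}\big)\delta_{jj'}-\widetilde G_z(y_j-y_{j'})\Big]_{j,j'=1}^N,\qquad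 \widetilde G_z(x)=G_z(x)\ (x\ne0),\quad \widetilde G_z(0)=0 .$$ Resonances: the multiset $\Sigma(H_{a,Y})$ of resonances of $H_{a,Y}$ is, by definition, the multiset of zeros $k\in\mathbb{C}$ of the entire function $z\mapsto\det\Gamma_{a,Y}(z)$, counted with multiplicity as zeros of this function. Counting function: $\mathcal{N}_{H_{a,Y}}(R)=\#\{k\in\Sigma(H_{a,Y}) : |k|<R\}$, counted with multiplicity. Size of $Y$: $V(Y)=\max_{\sigma\in S_N}\sum_{j=1}^N|y_j-y_{\sigma(j)}|$, where $S_N$ is the symmetric group on $\{1,\dots,N\}$ and $|\cdot|$ is the Euclidean norm in $\mathbb{R}^3$. *)

(* Defs.v *)
From HB Require Import structures.
From mathcomp Require Import all_boot all_order all_algebra all_fingroup.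
From mathcomp Require Import complex.
From mathcomp Require Import all_classical all_reals all_analysis.

Set Implicit Arguments.
Unset Strict Implicit.
Unset Printing Implicit Defensive.

Import Order.TTheory GRing.Theory Num.Theory.
Import numFieldNormedType.Exports.

Local Open Scope classical_set_scope.
Local Open Scope ring_scope.
Local Open Scope complex_scope.

(* The library norm on row vectors is the sup norm. *)
Definition l2norm (R : realType) (n : nat) (x : 'rV[R]_n) : R :=
  Num.sqrt (\sum_(i < n) x 0 i ^+ 2).

Record config (R : realType) (N : nat) := Config {
  center :> 'I_N -> 'rV[R]_3;
  center_inj : injective center
}.

HB.instance Definition _ (R : realType) (N : nat) := gen_eqMixin (config R N).
HB.instance Definition _ (R : realType) (N : nat) :=
  gen_choiceMixin (config R N).

Definition config_dist (R : realType) (N : nat) (Y Z : config R N) : R :=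
  Num.sqrt (\sum_(j < N) l2norm (Y j - Z j) ^+ 2).

Section L2norm.
Variable R : realType.

Lemma sqrt_sum_sqrD (n : nat) (u v : 'I_n -> R) :
  Num.sqrt (\sum_(i < n) (u i + v i) ^+ 2) <=
  Num.sqrt (\sum_(i < n) u i ^+ 2) + Num.sqrt (\sum_(i < n) v i ^+ 2).
Proof.
set A := \sum_(i < n) u i ^+ 2; set B := \sum_(i < n) v i ^+ 2.
have A0 : 0 <= A by apply: sumr_ge0 => i _; exact: sqr_ge0.
have B0 : 0 <= B by apply: sumr_ge0 => i _; exact: sqr_ge0.
pose C := \sum_(i < n) u i * v i.
have quad t s : 0 <= t ^+ 2 * A + (t * s * C) *+ 2 + s ^+ 2 * B.
  have -> : t ^+ 2 * A + (t * s * C) *+ 2 + s ^+ 2 * B =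
      \sum_(i < n) (t * u i + s * v i) ^+ 2.
    rewrite /A /B /C !mulr_sumr -sumrMnl -!big_split /=.
    apply: eq_bigr => i _; rewrite sqrrD !exprMn; congr (_ + _ *+ 2 + _).
    by rewrite mulrACA.
  by apply: sumr_ge0 => i _; exact: sqr_ge0.
have CS : C <= Num.sqrt A * Num.sqrt B.
  have CC : C ^+ 2 <= A * B.
    have [A00|A00] := eqVneq A 0.
      have -> : C = 0.
        apply: big1 => i _; have /eqP := A00.
        rewrite psumr_eq0 => [/allP/(_ i)|j _]; last exact: sqr_ge0.
        by rewrite mem_index_enum /= sqrf_eq0 => /(_ isT)/eqP ->; rewrite mul0r.
      by rewrite expr0n A00 mul0r.
    have Agt0 : 0 < A by rewrite lt_neqAle eq_sym A00.
    have := quad (- C) A.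
    have -> : (- C) ^+ 2 * A + (- C * A * C) *+ 2 + A ^+ 2 * B =
        A * (A * B - C ^+ 2).
      rewrite sqrrN mulrBr mulr2n !mulNr.
      have -> : C * A * C = C ^+ 2 * A by rewrite mulrAC -expr2.
      by rewrite addrA subrr add0r expr2 mulrA addrC [A * C ^+ 2]mulrC.
    by rewrite pmulr_rge0// subr_ge0.
  rewrite -sqrtrM// (le_trans (ler_norm _))// -sqrtr_sqr.
  exact: ler_wsqrtr.
rewrite -[leRHS]ger0_norm ?addr_ge0 ?sqrtr_ge0// -sqrtr_sqr ler_wsqrtr//.
have -> : \sum_(i < n) (u i + v i) ^+ 2 = A + C *+ 2 + B.
  rewrite /A /B /C -sumrMnl -!big_split /=.
  by apply: eq_bigr => i _; rewrite sqrrD.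
by rewrite sqrrD !sqr_sqrtr// lerD2r lerD2l lerMn2r CS orbT.
Qed.

Lemma l2normD (n : nat) (x y : 'rV[R]_n) :
  l2norm (x + y) <= l2norm x + l2norm y.
Proof.
rewrite /l2norm; under eq_bigr do rewrite mxE.
exact: (sqrt_sum_sqrD (fun i => x 0 i) (fun i => y 0 i)).
Qed.

Lemma l2norm_ge0 (n : nat) (x : 'rV[R]_n) : 0 <= l2norm x.
Proof. exact: sqrtr_ge0. Qed.

Lemma l2norm0 (n : nat) : l2norm (0 : 'rV[R]_n) = 0.
Proof.
by rewrite /l2norm big1 ?sqrtr0// => i _; rewrite mxE expr0n.
Qed.

Lemma l2normN (n : nat) (x : 'rV[R]_n) : l2norm (- x) = l2norm x.
Proof.
by rewrite /l2norm; congr Num.sqrt; apply: eq_bigr => i _; rewrite mxE sqrrN.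
Qed.

Lemma sqrt_sum_sqr_eq0 (n : nat) (u : 'I_n -> R) (i : 'I_n) :
  Num.sqrt (\sum_(j < n) u j ^+ 2) = 0 -> u i = 0.
Proof.
move/eqP; rewrite sqrtr_eq0 => le0.
have /eqP : \sum_(j < n) u j ^+ 2 = 0.
  by apply/eqP; rewrite eq_le le0 sumr_ge0// => j _; exact: sqr_ge0.
rewrite psumr_eq0 => [/allP/(_ i)|j _]; last exact: sqr_ge0.
by rewrite mem_index_enum /= sqrf_eq0 => /(_ isT)/eqP.
Qed.

Variable N : nat.
Implicit Types Y Z W : config R N.

Lemma config_distxx Y : config_dist Y Y = 0.
Proof.
by rewrite /config_dist big1 ?sqrtr0// => j _; rewrite subrr l2norm0 expr0n.
Qed.

Lemma config_dist_positivity Y Z : config_dist Y Z = 0 -> Y = Z.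
Proof.
move=> d0; have YZ : center Y = center Z.
  apply/funext => j; apply/rowP => i.
  have dj0 := @sqrt_sum_sqr_eq0 N (fun k => l2norm (Y k - Z k)) j d0.
  have := @sqrt_sum_sqr_eq0 3 (fun k => (Y j - Z j) 0 k) i dj0.
  by rewrite !mxE => /eqP; rewrite subr_eq0 => /eqP.
case: Y Z YZ {d0} => [y yi] [z zi] /= yz; subst z.
by congr Config; exact: Prop_irrelevance.
Qed.

Lemma config_dist_sym Y Z : config_dist Y Z = config_dist Z Y.
Proof.
rewrite /config_dist; congr Num.sqrt; apply: eq_bigr => j _.
by rewrite -l2normN opprB.
Qed.

Lemma config_dist_triangle Z Y W :
  config_dist Y W <= config_dist Y Z + config_dist Z W.
Proof.
apply: le_trans (sqrt_sum_sqrD _ _); apply: ler_wsqrtr; apply: ler_sum => j _.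
rewrite lerXn2r ?nnegrE ?addr_ge0 ?l2norm_ge0//.
by rewrite (le_trans _ (l2normD _ _))// addrA subrK.
Qed.

HB.instance Definition _ := @isMetric.Build R (config R N)
  (@config_dist R N) config_distxx config_dist_positivity config_dist_sym
  config_dist_triangle.

End L2norm.

Definition cexp (R : realType) (z : R[i]) : R[i] :=
  let: x +i* y := z in (expR x * cos y) +i* (expR x * sin y).

Definition green (R : realType) (z : R[i]) (x : 'rV[R]_3) : R[i] :=
  cexp ('i * z * (l2norm x)%:C) / (4 * pi * l2norm x)%:C.

Definition green_tilde (R : realType) (z : R[i]) (x : 'rV[R]_3) : R[i] :=
  if x == 0 then 0 else green z x.

Definition Gamma (R : realType) (N : nat) (a : 'I_N -> R[i])
    (Y : config R N) (z : R[i]) : 'M[R[i]]_N :=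
  \matrix_(j, j') ((a j - 'i * z / (4 * pi)%:C) *+ (j == j')
                   - green_tilde z (Y j - Y j')).

(* Order of vanishing of f at k, for f holomorphic near k: the supremum of
   the n such that f and its complex derivatives of order less than n vanish at
   k. It is 0 if f k != 0, and +oo if f vanishes identically near k. *)
Definition zero_mult (R : realType) (f : R[i] -> R[i]^o) (k : R[i]) : \bar R :=
  ereal_sup [set n%:R%:E | n in
    [set n | forall m, (m < n)%N -> derive1n m f k = 0]].

(* The multiset of resonances of H_{a,Y}, given by its multiplicity function. *)
Definition resonance_mult (R : realType) (N : nat) (a : 'I_N -> R[i])
    (Y : config R N) : R[i] -> \bar R :=
  zero_mult (fun z => \det (Gamma a Y z)).

Definition resonance_count (R : realType) (N : nat) (a : 'I_N -> R[i])
    (Y : config R N) (r : R) : \bar R :=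
  \esum_(k in [set k : R[i] | `|k| < r%:C]) resonance_mult a Y k.

(* The neutral element 0 is harmless: all the sums are nonnegative. *)
Definition config_size (R : realType) (N : nat) (Y : config R N) : R :=
  \big[Num.max/0]_(s : 'S_N) \sum_(j < N) l2norm (Y j - Y (s j)).

(* Main.v *)
From HB Require Import structures.
Require Import Defs.
From mathcomp Require Import all_boot all_order all_algebra all_fingroup.
From mathcomp Require Import complex.
From mathcomp Require Import all_classical all_reals all_analysis.
From mathcomp Require Import ring lra.

(* The determinant of Gamma expands over permutations s into an exponential sum
   f(z) = sum_s P_s(z) exp(i V_s z) with polynomial coefficients, where V_s is
   the sum of the |y_j - y_s(j)|. For generic Y two permutations with V_s = V_t
   have the same undirected cycles, hence the same sign and the same fixed
   points, so the coefficient of the top frequency V(Y) does not cancel; the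
   coefficient of the frequency 0 comes from the identity alone.
   Above a parabola-like region f is dominated by its frequency 0 part, below it
   by its frequency V(Y) part, so large zeros satisfy (Im z)^2 < |z|, and the disc
   of radius R can be replaced by a rectangle |Re z| <= X with X close to R. By
   the argument principle the zeros in the rectangle are counted by the variation
   of the argument of f along its boundary. The bottom side contributes
   2 X V(Y) + O(1) and the three others O(1): after removing the factor
   exp(i V(Y) z), the real part of f or of its dominant coefficient along a side
   is a real exponential sum in one variable, and by Rolle's theorem its number
   of zeros is bounded independently of the side. *)

(** An error O(1) requires a bound for the variation of the argument along each side that is uniform
    in the rectangle. On a straight side the real part in question has a number of zeros bounded by
    the sizes of the polynomials alone; a circle gives no such real exponential sum, which is why
    the disc is replaced by a rectangle. A vertical side crosses the region where no term dominates,
    but there the phases exp(i V_s x) are constants that the coefficients absorb. The argument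
    principle is obtained without contour integrals: the zeros are divided out, the continuous
    zero-free cofactor has a continuous argument on the whole rectangle, and each factor z - k turns
    exactly once. Genericity is dense for the following reason. If V_s = V_t near Y, then the second
    mixed difference under moving y_i and y_j by a common vector isolates |y_i - y_j|, so s and t
    use that pair equally often. *)

Set Implicit Arguments.
Unset Strict Implicit.
Unset Printing Implicit Defensive.

Import Order.TTheory GRing.Theory Num.Theory.
Import numFieldNormedType.Exports.

Local Open Scope classical_set_scope.
Local Open Scope ring_scope.
Local Open Scope complex_scope.
Local Notation Re := complex.Re.
Local Notation Im := complex.Im.

(** * Complex numbers and the complex exponential *)

(* The topology that [derive1n] uses on [R[i]] is that of [R[i]^o]. *)
HB.instance Definition _ (R : realType) := NormedModule.copy R[i] (R[i]^o).

Lemma continuous_sum_for (R : realType) (T : topologicalType) (I : eqType)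
    (r : seq I) (F : I -> T -> R) (x : T) :
  (forall i, i \in r -> {for x, continuous (F i)}) ->
  {for x, continuous (fun y => \sum_(i <- r) F i y)}.
Proof.
elim: r => [|i r ih] cF.
  have -> : (fun y => \sum_(i <- [::]) F i y) = cst 0.
    by apply/funext => y; rewrite big_nil.
  exact: cst_continuous.
have -> : (fun y => \sum_(j <- i :: r) F j y) =
    F i + (fun y => \sum_(j <- r) F j y) :> (T -> R).
  by apply/funext => y; rewrite big_cons.
apply: continuousD; first by apply: cF; rewrite mem_head.
by apply: ih => j jr; apply: cF; rewrite in_cons jr orbT.
Qed.

Section ComplexBasics.
Context {R : realType}.
Local Notation C := R[i].
Local Notation nrm := (@Normc.normc R).

(** The norm [|z|] is an element of [R[i]]; the estimates below are made with the real number
    [nrm z]. *)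
Lemma normc_nrm (z : C) : `|z| = (nrm z)%:C.
Proof. by []. Qed.

Lemma nrm_ge0 (z : C) : 0 <= nrm z.
Proof. by case: z => a b; exact: sqrtr_ge0. Qed.

Lemma nrm_eq0 (z : C) : (nrm z == 0) = (z == 0).
Proof.
apply/eqP/eqP; first exact: Normc.eq0_normc.
by move=> ->; exact: Normc.normc0.
Qed.

Lemma nrm_gt0 (z : C) : (0 < nrm z) = (z != 0).
Proof. by rewrite lt_neqAle nrm_ge0 andbT eq_sym nrm_eq0. Qed.

Lemma nrm0 : nrm 0 = 0. Proof. exact: Normc.normc0. Qed.
Lemma nrm1 : nrm 1 = 1. Proof. exact: Normc.normc1. Qed.

Lemma nrmM (z w : C) : nrm (z * w) = nrm z * nrm w.
Proof. exact: Normc.normcM. Qed.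

Lemma nrmV (z : C) : nrm z^-1 = (nrm z)^-1.
Proof. exact: Normc.normcV. Qed.

Lemma nrmX (z : C) n : nrm (z ^+ n) = nrm z ^+ n.
Proof. by elim: n => [|n ih]; rewrite ?expr0 ?nrm1// !exprS nrmM ih. Qed.

Lemma nrmN (z : C) : nrm (- z) = nrm z.
Proof. by case: z => a b /=; rewrite !sqrrN. Qed.

Lemma nrmB (z w : C) : nrm (z - w) = nrm (w - z).
Proof. by rewrite -nrmN opprB. Qed.

Lemma nrmD (z w : C) : nrm (z + w) <= nrm z + nrm w.
Proof. exact: le_normcD. Qed.

Lemma nrm_dist (z w : C) : nrm z - nrm w <= nrm (z - w).
Proof. by rewrite lerBlDr (le_trans _ (nrmD _ _))// subrK. Qed.

Lemma nrm_sum (I : Type) (r : seq I) (P : pred I) (F : I -> C) :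
  nrm (\sum_(i <- r | P i) F i) <= \sum_(i <- r | P i) nrm (F i).
Proof.
elim/big_ind2 : _ => [|x a y b xa yb|//]; first by rewrite nrm0.
by rewrite (le_trans (nrmD _ _))// lerD.
Qed.

Lemma nrmC (x : R) : nrm x%:C = `|x|.
Proof. by rewrite /= expr0n addr0 sqrtr_sqr. Qed.

Lemma ReMc (z w : C) : Re (z * w) = Re z * Re w - Im z * Im w.
Proof. by case: z => a b; case: w => c d. Qed.

Lemma ImMc (z w : C) : Im (z * w) = Re z * Im w + Im z * Re w.
Proof. by case: z => a b; case: w => c d. Qed.

Lemma ReDc (z w : C) : Re (z + w) = Re z + Re w.
Proof. by case: z => a b; case: w => c d. Qed.

Lemma ImDc (z w : C) : Im (z + w) = Im z + Im w.
Proof. by case: z => a b; case: w => c d. Qed.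

Lemma ReNc (z : C) : Re (- z) = - Re z.
Proof. by case: z. Qed.

Lemma ImNc (z : C) : Im (- z) = - Im z.
Proof. by case: z. Qed.

Lemma nrm_sqr (z : C) : nrm z ^+ 2 = Re z ^+ 2 + Im z ^+ 2.
Proof. by case: z => a b /=; rewrite sqr_sqrtr// addr_ge0 ?sqr_ge0. Qed.

Lemma Re_le_nrm (z : C) : `|Re z| <= nrm z.
Proof.
by case: z => a b /=; rewrite -sqrtr_sqr ler_wsqrtr// lerDl sqr_ge0.
Qed.

Lemma Im_le_nrm (z : C) : `|Im z| <= nrm z.
Proof.
by case: z => a b /=; rewrite -sqrtr_sqr ler_wsqrtr// lerDr sqr_ge0.
Qed.

Lemma nrm_le_ReIm (z : C) : nrm z <= `|Re z| + `|Im z|.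
Proof.
rewrite {1}[z]complexE (le_trans (nrmD _ _))// nrmM !nrmC.
have -> : nrm 'i = 1 by rewrite /= expr0n expr1n add0r sqrtr1.
by rewrite mul1r.
Qed.

Lemma cvg_nrmP {T : Type} {F : set_system T} {FF : Filter F} (f : T -> C)
    (l : C) :
  f @ F --> l <-> forall e : R, 0 < e -> \forall t \near F, nrm (l - f t) < e.
Proof.
split=> [/cvgrPdist_lt cf e e0|cf].
  have := cf e%:C; rewrite ltcR => /(_ e0).
  by apply: filterS => t; rewrite normc_nrm ltcR.
apply/cvgrPdist_lt => e e0.
have eE : e = (Re e)%:C by rewrite RRe_real// realE ltW.
have Re0 : 0 < Re e by rewrite -ltcR -eE.
by apply: filterS (cf _ Re0) => t; rewrite eE normc_nrm ltcR.
Qed.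

Lemma nbhs_nrmP (z : C) (A : set C) :
  nbhs z A <-> exists2 d : R, 0 < d & forall w, nrm (w - z) < d -> A w.
Proof.
split=> [/nbhs_ballP[e /= e0 zeA]|[d d0 dA]].
  have eE : e = (Re e)%:C by rewrite RRe_real// realE ltW.
  exists (Re e); first by rewrite -ltcR -eE.
  move=> w wz; apply: zeA; rewrite -ball_normE /ball_ /= eE normc_nrm ltcR.
  by rewrite nrmB.
apply/nbhs_ballP; exists d%:C => /=; first by rewrite ltcR.
move=> w; rewrite -ball_normE /ball_ /= normc_nrm ltcR nrmB.
exact: dA.
Qed.

Lemma continuous_Re : continuous (@Re R : C -> R).
Proof.
move=> z; apply/(cvgrPdist_lt (FF := nbhs_filter z)) => e e0.
apply/nbhs_nrmP; exists e => // w we.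
by rewrite -ReNc -ReDc (le_lt_trans (Re_le_nrm _))// nrmB.
Qed.

Lemma continuous_Im : continuous (@Im R : C -> R).
Proof.
move=> z; apply/(cvgrPdist_lt (FF := nbhs_filter z)) => e e0.
apply/nbhs_nrmP; exists e => // w we.
by rewrite -ImNc -ImDc (le_lt_trans (Im_le_nrm _))// nrmB.
Qed.

Lemma cvg_complex {T : Type} {F : set_system T} {FF : Filter F} (f g : T -> R)
    (a b : R) :
  f @ F --> a -> g @ F --> b -> (fun t => f t +i* g t) @ F --> a +i* b.
Proof.
move=> /cvgrPdist_lt fa /cvgrPdist_lt gb; apply/cvg_nrmP => e e0.
have e20 : 0 < e / 2 by rewrite divr_gt0.
near=> t; rewrite (le_lt_trans (nrm_le_ReIm _))//.
rewrite [ltRHS]splitr ltrD//=; near: t; [exact: fa|exact: gb].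
Unshelve. all: by end_near. Qed.

Lemma continuous_real_complex : continuous (fun x : R => x%:C).
Proof. by move=> x; apply: cvg_complex; [exact: cvg_id|exact: cvg_cst]. Qed.

(** * The complex exponential and its expansion at 0 *)

Lemma cexpD (z w : C) : cexp (z + w) = cexp z * cexp w.
Proof.
case: z => a b; case: w => c d; apply/eqP; rewrite eq_complex /=.
rewrite expRD sinD cosD; apply/andP; split; apply/eqP; ring.
Qed.

Lemma cexp0 : cexp (0 : C) = 1.
Proof. by apply/eqP; rewrite eq_complex /= expR0 cos0 sin0 mulr0 mulr1 !eqxx. Qed.

Lemma nrm_cexp (z : C) : nrm (cexp z) = expR (Re z).
Proof.
case: z => a b /=; rewrite !exprMn -mulrDr cos2Dsin2 mulr1 sqrtr_sqr.
by rewrite gtr0_norm// expR_gt0.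
Qed.

Lemma cexp_neq0 (z : C) : cexp z != 0.
Proof. by rewrite -nrm_gt0 nrm_cexp expR_gt0. Qed.

Lemma cexpN (z : C) : cexp (- z) = (cexp z)^-1.
Proof.
apply: (mulfI (cexp_neq0 z)); rewrite -cexpD subrr cexp0.
by rewrite divff// cexp_neq0.
Qed.

Lemma cexp_sum (I : Type) (r : seq I) (P : pred I) (F : I -> C) :
  cexp (\sum_(i <- r | P i) F i) = \prod_(i <- r | P i) cexp (F i).
Proof.
elim/big_ind2 : _ => [|x a y b <- <-|//]; [exact: cexp0|exact: cexpD].
Qed.

Lemma real_derive_near (f : R -> R) (d e : R) : is_derive (0 : R) 1 f d -> 0 < e ->
  \forall h \near (0 : R), `|f h - f 0 - h * d| <= e * `|h|.
Proof.
move=> [df <-] e0.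
have /cvgrPdist_le/(_ _ e0) : h^-1 *: (f (h *: (1 : R) + 0) - f 0) @[h --> 0^'] -->
   'D_1 f 0 by exact: df.
rewrite near_withinE; apply: filterS => h hE.
have [->|h0] := eqVneq h 0.
  by rewrite subrr mul0r subr0 normr0 mulr0.
have := hE h0; rewrite /GRing.scale /= mulr1 addr0 => {hE}.
rewrite -(ler_pM2r (x := `|h|)) ?normr_gt0// -normrM mulrBl mulrAC mulVf// mul1r.
by rewrite distrC [h * _]mulrC.
Qed.

Lemma cexp_near0 (e : R) : 0 < e -> exists2 d : R, 0 < d &
  forall h : C, nrm h < d -> nrm (cexp h - 1 - h) <= e * nrm h.
Proof.
(* The 9 is the sum of the bounds 4 and 5 obtained below for the real and the imaginary part;
   [u <= 1] keeps [expR x] below 3. *)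
move=> e0; pose u := Num.min (e / 9) 1.
have u0 : 0 < u by rewrite lt_min divr_gt0//= ltr01.
have u1 : u <= 1 by rewrite ge_min lexx orbT.
have ue : 9 * u <= e by rewrite mulrC -ler_pdivlMr// ge_min lexx.
have E1 := real_derive_near (is_derive_expR 0) u0.
have E2 := real_derive_near (is_derive_cos 0) u0.
have E3 := real_derive_near (is_derive_sin 0) u0.
have E : \forall h \near (0 : R), [/\ `|expR h - 1 - h| <= u * `|h|,
   `|cos h - 1| <= u * `|h|, `|sin h - h| <= u * `|h| & `|h| <= u].
  near=> h; split.
  - by have : `|expR h - expR 0 - h * expR 0| <= u * `|h|;
      [near: h|rewrite expR0 mulr1].
  - by have : `|cos h - cos 0 - h * - sin 0| <= u * `|h|;
      [near: h|rewrite cos0 sin0 oppr0 mulr0 subr0].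
  - by have : `|sin h - sin 0 - h * cos 0| <= u * `|h|;
      [near: h|rewrite sin0 cos0 mulr1 subr0].
  - near: h; apply/nbhs_ballP; exists u => //= h.
    by rewrite /ball/= sub0r normrN => /ltW.
have /nbhs_ballP[d /= d0 dE] := E.
exists d => // -[x y] xyd.
have xn : `|x| <= nrm (x +i* y) := Re_le_nrm (x +i* y).
have yn : `|y| <= nrm (x +i* y) := Im_le_nrm (x +i* y).
set N := nrm (x +i* y) in xyd xn yn *.
have [|Ex _ _ xu] := dE x.
  by rewrite /ball/= sub0r normrN (le_lt_trans _ xyd).
have [|_ Ec Es _] := dE y.
  by rewrite /ball/= sub0r normrN (le_lt_trans _ xyd).
have ex1 : `|expR x - 1| <= 2 * `|x|.
  have -> : expR x - 1 = (expR x - 1 - x) + x by ring.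
  rewrite (le_trans (ler_normD _ _))// mulr_natl mulr2n lerD2r.
  by rewrite (le_trans Ex)// ler_piMl.
have ex3 : `|expR x| <= 3.
  have -> : expR x = (expR x - 1) + 1 by ring.
  rewrite (le_trans (ler_normD _ _))// normr1.
  have : `|x| <= 1 by exact: le_trans u1.
  by move: ex1; lra.
have N0 : 0 <= N by exact: nrm_ge0.
have uxN : u * `|x| <= u * N by rewrite ler_wpM2l// ltW.
have uyN : u * `|y| <= u * N by rewrite ler_wpM2l// ltW.
rewrite (le_trans (nrm_le_ReIm _))// (@le_trans _ _ (9 * u * N))//; last first.
  by rewrite ler_wpM2r.
rewrite !ReDc !ImDc !ReNc !ImNc /= subr0.
have A1 : `|expR x * cos y - 1 - x| <= 4 * (u * N).
  have -> : expR x * cos y - 1 - x = expR x * (cos y - 1) + (expR x - 1 - x).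
    by ring.
  rewrite (le_trans (ler_normD _ _))// normrM.
  have : `|expR x| * `|cos y - 1| <= 3 * (u * N).
    by rewrite ler_pM// (le_trans Ec).
  by move: Ex uxN; lra.
have A2 : `|expR x * sin y - y| <= 5 * (u * N).
  have -> : expR x * sin y - y = expR x * (sin y - y) + (expR x - 1) * y.
    by ring.
  rewrite (le_trans (ler_normD _ _))// !normrM.
  have B1 : `|expR x| * `|sin y - y| <= 3 * (u * N).
    by rewrite ler_pM// (le_trans Es).
  have B2 : `|expR x - 1| * `|y| <= (2 * u) * N.
    rewrite ler_pM// (le_trans ex1)// ler_wpM2l//.
  by move: B1 B2; lra.
by move: A1 A2; lra.
Unshelve. all: by end_near. Qed.

End ComplexBasics.

(** * Complex derivatives and exponential sums *)

Section ComplexDerivative.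
Context {R : realType}.
Local Notation C := R[i].
Local Notation nrm := (@Normc.normc R).

Lemma is_derive_nrmP (f : C -> C) (z d : C) : is_derive z 1 f d <->
  forall e : R, 0 < e -> exists2 r : R, 0 < r &
    forall h : C, nrm h < r -> nrm (f (z + h) - f z - d * h) <= e * nrm h.
Proof.
split=> [[df <-] e e0|H].
  have /cvg_nrmP/(_ _ e0) : h^-1 *: (f (h *: (1 : C) + z) - f z) @[h --> 0^'] -->
     'D_1 f z by exact: df.
  rewrite near_withinE => /nbhs_nrmP[r r0 rH]; exists r => // h hr.
  have [->|h0] := eqVneq h 0.
    by rewrite mulr0 addr0 subrr subr0 nrm0 mulr0.
  have := rH h; rewrite subr0 => /(_ hr h0).
  rewrite /GRing.scale /= mulr1 => /ltW.
  rewrite -(ler_pM2r (x := nrm h)) ?nrm_gt0// -nrmM mulrBl mulrAC mulVf// mul1r.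
  by rewrite nrmB [h + z]addrC.
have dH : h^-1 *: (f (h *: (1 : C) + z) - f z) @[h --> 0^'] --> d.
  apply/cvg_nrmP => e e0; rewrite near_withinE.
  have [r r0 rH] := H _ (divr_gt0 e0 (ltr0Sn R 1)).
  apply/nbhs_nrmP; exists r => // h; rewrite subr0 => hr h0.
  have := rH h hr; rewrite /GRing.scale /= mulr1 => {}rH.
  rewrite -(ltr_pM2r (x := nrm h)) ?nrm_gt0// -nrmM mulrBl mulrAC mulVf// mul1r.
  rewrite nrmB [h + z]addrC (le_lt_trans rH)// ltr_pM2r ?nrm_gt0//.
  by rewrite ltr_pdivrMr// ltr_pMr// ltr1n.
have df : derivable f z 1 by apply/cvg_ex; exists d.
by split => //; exact: cvg_lim dH.
Qed.

Lemma is_derive_cexpM (b z : C) :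
  is_derive z 1 (fun w => cexp (b * w)) (b * cexp (b * z)).
Proof.
apply/is_derive_nrmP => e e0.
pose K := nrm (cexp (b * z)) * (nrm b + 1).
have K0 : 0 < K by rewrite mulr_gt0 ?nrm_gt0 ?cexp_neq0 ?ltr_wpDl ?nrm_ge0.
have [r r0 rH] := cexp_near0 (divr_gt0 e0 K0).
have b1 : 0 < nrm b + 1 by rewrite ltr_wpDl ?nrm_ge0.
exists (r / (nrm b + 1)); first by rewrite divr_gt0.
move=> h hr; have bh : nrm (b * h) <= (nrm b + 1) * nrm h.
  by rewrite nrmM ler_wpM2r ?nrm_ge0// lerDl.
have {}/rH : nrm (b * h) < r.
  by rewrite (le_lt_trans bh)// mulrC -ltr_pdivlMr.
rewrite mulrDr cexpD => rH.
have -> : cexp (b * z) * cexp (b * h) - cexp (b * z) - b * cexp (b * z) * h =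
  cexp (b * z) * (cexp (b * h) - 1 - b * h) by ring.
rewrite nrmM (@le_trans _ _ (nrm (cexp (b * z)) * (e / K * nrm (b * h))))//.
  by rewrite ler_wpM2l ?nrm_ge0.
rewrite (@le_trans _ _ (nrm (cexp (b * z)) *
    (e / K * ((nrm b + 1) * nrm h))))//.
  by rewrite ler_wpM2l ?nrm_ge0// ler_wpM2l// ltW// divr_gt0.
rewrite /K le_eqVlt; apply/orP; left; apply/eqP; field.
by rewrite !gt_eqF// nrm_gt0 cexp_neq0.
Qed.

Lemma is_derive_horner (p : {poly C}) (z : C) :
  is_derive z 1 (horner p) (p^`()).[z].
Proof.
elim/poly_ind: p => [|p c ih].
  rewrite deriv0 horner0.
  have -> : horner (0 : {poly C}) = cst 0 by apply/funext => y /=; rewrite horner0.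
  exact: is_derive_cst.
have -> : horner (p * 'X + c%:P) = (horner p * id + cst c :> (C -> C)).
  by apply/funext => y /=; rewrite !hornerE.
apply: is_derive_eq; rewrite derivD derivM derivX derivC mulr1 addr0 hornerD.
rewrite !hornerE /GRing.scale/=. ring.
Qed.

(** A pair (p, b) stands for p(z) exp(b z), and frequencies may repeat. With lists, D and D - b
    become maps that act on each pair separately. *)
Definition expsum (l : seq ({poly C} * C)) (z : C) : C :=
  \sum_(p <- l) p.1.[z] * cexp (p.2 * z).

Definition expsumD (l : seq ({poly C} * C)) :=
  [seq (p.1^`() + p.2 *: p.1, p.2) | p <- l].

Lemma is_derive_expsum l (z : C) : is_derive z 1 (expsum l) (expsum (expsumD l) z).
Proof.
elim: l => [|[p b] l ih].
  have -> : expsum [::] = cst 0 by apply/funext => y; rewrite /expsum big_nil.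
  exact: is_derive_cst.
have -> : expsum ((p, b) :: l) =
    (horner p * (fun w => cexp (b * w)) + expsum l :> (C -> C)).
  by apply/funext => y; rewrite /expsum big_cons.
have h1 := is_derive_horner p z; have h2 := is_derive_cexpM b z.
apply: is_derive_eq; rewrite [in RHS]/expsum /= big_cons /= -/(expsum _ _).
rewrite hornerD hornerZ /GRing.scale /=; ring.
Qed.

Lemma derive1n_expsum m l : derive1n m (expsum l : C -> C^o) = expsum (iter m expsumD l).
Proof.
elim: m => [//|m ih]; rewrite derive1nS ih /=.
apply/funext => z; rewrite derive1E.
exact: (derive_val (is_derive := is_derive_expsum (iter m expsumD l) z)).
Qed.

Lemma continuous_is_derive (f : C -> C) (df : C -> C) :
  (forall z : C, is_derive z 1 f (df z)) -> continuous f.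
Proof.
move=> fdf z.
by apply: differentiable_continuous; apply/derivable1_diffP; exact: (ex_derive (is_derive := fdf z)).
Qed.

(* The restrictions to which the real mean value theorem is applied. *)
Lemma is_derive_Re_line (h : C -> C) (k w u : C) (t : R) (d : C) :
  is_derive (k + t%:C * w) 1 h d ->
  is_derive t 1 (fun s : R => Re (u * h (k + s%:C * w))) (Re (u * d * w)).
Proof.
move=> /is_derive_nrmP H.
pose K := (nrm u + 1) * (nrm w + 1).
have u1 : 0 < nrm u + 1 by rewrite ltr_wpDl ?nrm_ge0.
have w1 : 0 < nrm w + 1 by rewrite ltr_wpDl ?nrm_ge0.
have K0 : 0 < K by rewrite mulr_gt0.
have dH : s^-1 *: (Re (u * h (k + (s *: (1 : R) + t)%:C * w)) -
    Re (u * h (k + t%:C * w))) @[s --> 0^'] --> Re (u * d * w).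
  apply/cvgrPdist_le => e e0; rewrite near_withinE.
  have [r r0 rH] := H _ (divr_gt0 e0 K0).
  apply/nbhs_ballP; exists (r / (nrm w + 1)); first exact: divr_gt0.
  move=> s; rewrite /ball /= sub0r normrN => sr s0.
  have sw : nrm (s%:C * w) <= `|s| * (nrm w + 1).
    by rewrite nrmM nrmC ler_wpM2l// lerDl.
  have {}/rH rH : nrm (s%:C * w) < r.
    by rewrite (le_lt_trans sw)// -ltr_pdivlMr.
  rewrite -(ler_pM2r (x := `|s|)) ?normr_gt0// -normrM mulrBl.
  rewrite /GRing.scale /= [s^-1 * _ * s]mulrAC mulVf// mul1r mulr1 -ReNc -ReDc.
  set X := h _ in rH; set Y := h _ in rH.
  have -> : h (k + (s + t)%:C * w) = X.
    by congr h; rewrite rmorphD /=; ring.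
  have -> : Re (u * d * w) * s - Re (u * X - u * Y) =
            Re (- (u * (X - Y - d * (s%:C * w)))).
    have -> : - (u * (X - Y - d * (s%:C * w))) =
      (u * d * w) * s%:C - (u * X - u * Y) by ring.
    by rewrite [in RHS]ReDc ReNc (ReMc _ s%:C) /= mulr0 subr0.
  rewrite (le_trans (Re_le_nrm _))// nrmN nrmM.
  rewrite (@le_trans _ _ ((nrm u + 1) * (e / K * nrm (s%:C * w))))//.
    by rewrite ler_pM ?nrm_ge0// lerDl.
  rewrite (@le_trans _ _ ((nrm u + 1) * (e / K * (`|s| * (nrm w + 1)))))//.
    by rewrite ler_wpM2l ?(ltW u1)// ler_wpM2l ?(ltW (divr_gt0 e0 K0)).
  rewrite /K le_eqVlt; apply/orP; left; apply/eqP; field.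
  by rewrite !gt_eqF.
have df : derivable (fun s : R => Re (u * h (k + s%:C * w))) t 1.
  by apply/cvg_ex; eexists; exact: dH.
by split => //; exact: cvg_lim dH.
Qed.

(** Multiplying by a unit [u] that turns [h z - h k] into its modulus reduces the inequality to the
    real mean value theorem for Re (u h) on the segment from k to z. *)
Lemma complex_MVT_le (h dh : C -> C) (k z : C) (M : R) :
  (forall w : C, is_derive w 1 h (dh w)) ->
  (forall w, nrm (w - k) <= nrm (z - k) -> nrm (dh w) <= M) ->
  nrm (h z - h k) <= M * nrm (z - k).
Proof.
move=> hdh dhM.
have [hzk|hzk] := eqVneq (h z - h k) 0.
  rewrite hzk nrm0 mulr_ge0 ?nrm_ge0// (le_trans (nrm_ge0 (dh z)))// dhM//.
have [u u1 uE] : exists2 u : C, nrm u = 1 &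
    u * (h z - h k) = (nrm (h z - h k))%:C.
  exists ((nrm (h z - h k))%:C / (h z - h k)); last by rewrite divfK.
  by rewrite nrmM nrmV nrmC ger0_norm ?nrm_ge0// divff// nrm_eq0.
pose phi (s : R) := Re (u * h (k + s%:C * (z - k))).
have dphi (s : R) : is_derive s 1 phi (Re (u * dh (k + s%:C * (z - k)) * (z - k))).
  exact: is_derive_Re_line.
have [|c c01] := @MVT_segment R phi _ 0 1 ler01 (fun s _ => dphi s).
  apply: derivable_within_continuous => s _.
  exact: (ex_derive (is_derive := dphi s)).
rewrite /phi rmorph1 rmorph0 mul1r mul0r addr0 [k + _]addrC subrK subr0 mulr1.
rewrite -ReNc -ReDc -mulrBr uE /= => ->.
rewrite (le_trans (ler_norm _))// (le_trans (Re_le_nrm _))// !nrmM u1 mul1r.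
rewrite ler_wpM2r ?nrm_ge0// dhM// addrAC subrr add0r nrmM nrmC.
rewrite ler_piMl ?nrm_ge0//.
by move: c01; rewrite in_itv /= => /andP[c0 c1]; rewrite ger0_norm.
Qed.

Lemma is_derive0_const (h : C -> C) (k z : C) :
  (forall w : C, is_derive w 1 h 0) -> h z = h k.
Proof.
move=> h0; apply/eqP; rewrite -subr_eq0 -nrm_eq0 eq_le nrm_ge0 andbT.
rewrite (le_trans (complex_MVT_le (M := 0) h0 _)) ?mul0r// => w _.
by rewrite nrm0.
Qed.

End ComplexDerivative.

(** * Orders of zeros *)

Section ZeroOrder.
Context {R : realType}.
Local Notation C := R[i].
Local Notation nrm := (@Normc.normc R).
Implicit Type l : seq ({poly C} * C).

(** Taylor's formula in Peano form. The induction applies the estimate to the derivative and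
    integrates it by the mean value inequality for [h]. *)
Lemma taylor_vanishing (m : nat) (F : nat -> C -> C) (k : C) :
  (forall n (z : C), is_derive z 1 (F n) (F n.+1 z)) ->
  (forall j, (j < m)%N -> F j k = 0) ->
  forall e : R, 0 < e -> exists2 r : R, 0 < r & forall z, nrm (z - k) < r ->
    nrm (F 0%N z - F m k / m`!%:R * (z - k) ^+ m) <= e * nrm (z - k) ^+ m.
Proof.
elim: m F => [|m ih] F dF Fk e e0.
  have /cvg_nrmP/(_ _ e0)/nbhs_nrmP[r r0 rF] : F 0%N z @[z --> k] --> F 0%N k.
    exact: (continuous_is_derive (dF 0%N)).
  exists r => // z /rF; rewrite fact0 divr1 !expr0 !mulr1 nrmB => /ltW.
  exact.
have [|r r0 rF] := ih (fun n => F n.+1) (fun n => dF n.+1) _ _ e0.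
  by move=> j jm; apply: Fk.
exists r => // z zr.
pose c := F m.+1 k / m.+1`!%:R.
pose h (w : C) := F 0%N w - c * (w - k) ^+ m.+1.
pose dh (w : C) := F 1%N w - c * (m.+1%:R * (w - k) ^+ m).
have hdh (w : C) : is_derive w 1 h (dh w).
  have d0 := dF 0%N w.
  have -> : h = F 0%N - c *: ((id - cst k : C -> C) ^+ m.+1) :> (C -> C).
    apply/funext => x; rewrite exprfctE.
    by [].
  apply: is_derive_eq; rewrite /dh /GRing.scale /= subr0 mulr1.
  by rewrite mulr_natl.
have hk : h k = 0 by rewrite /h subrr expr0n mulr0 subr0 Fk.
have := complex_MVT_le (k := k) (z := z) (M := e * nrm (z - k) ^+ m) hdh.
rewrite hk subr0 -mulrA -exprSr; apply => w wz.
have -> : dh w = F 1%N w - F m.+1 k / m`!%:R * (w - k) ^+ m.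
  rewrite /dh /c factS natrM; congr (_ - _); field.
  by rewrite -[1 + _]/(1%:R + _) -natrD !pnatr_eq0 -lt0n fact_gt0.
rewrite (le_trans (rF _ _))//; first exact: le_lt_trans zr.
by rewrite ler_wpM2l ?(ltW e0)// lerXn2r ?nnegrE ?nrm_ge0.
Qed.

(** By Taylor's formula the quotient by (z - k)^m extends continuously to k. Continuity is what the
    lifting of the argument asks of the cofactor. *)
Lemma expsum_factor l (k : C) (m : nat) :
  (forall j, (j < m)%N -> expsum (iter j expsumD l) k = 0) ->
  exists g : C -> C, [/\ {for k, continuous g},
    g k = expsum (iter m expsumD l) k / m`!%:R &
    forall z, expsum l z = (z - k) ^+ m * g z].
Proof.
move=> lk; set c := expsum (iter m expsumD l) k / m`!%:R.
pose g (z : C) := if z == k then c else expsum l z / (z - k) ^+ m.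
exists g; split; last 2 first.
- by rewrite /g eqxx.
- move=> z; rewrite /g; case: eqVneq => [->|zk]; last first.
    by rewrite mulrC divfK// expf_neq0// subr_eq0.
  case: m @c lk @g => [|m] c lk g; first by rewrite expr0 mul1r /c divr1.
  by rewrite subrr expr0n mul0r; apply: (lk 0%N).
apply/(cvg_nrmP (FF := nbhs_filter k)) => e e0.
have dF n (z : C) : is_derive z 1 (expsum (iter n expsumD l)) (expsum (iter n.+1 expsumD l) z).
  exact: is_derive_expsum.
have [r r0 rF] := taylor_vanishing (F := fun n => expsum (iter n expsumD l)) dF lk
  (divr_gt0 e0 (ltr0Sn R 1)).
apply/nbhs_nrmP; exists r => // w /rF wr.
rewrite /g eqxx; case: eqVneq => [_|wk]; first by rewrite subrr nrm0.
have wk0 : 0 < nrm (w - k) ^+ m by rewrite exprn_gt0// nrm_gt0 subr_eq0.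
rewrite -(ltr_pM2r wk0) -nrmX -nrmM mulrBl divfK ?expf_neq0 ?subr_eq0//.
rewrite nrmB (le_lt_trans wr)// -nrmX ltr_pM2r ?nrmX//.
by rewrite ltr_pdivrMr// ltr_pMr// ltr1n.
Qed.

(* The operator [D - b] on exponential polynomials. *)
Definition expsum_shift (b : C) l := [seq (p.1^`() + (p.2 - b) *: p.1, p.2) | p <- l].

Lemma expsum_shiftE b l z : expsum (expsum_shift b l) z = expsum (expsumD l) z - b * expsum l z.
Proof.
rewrite /expsum /expsum_shift /expsumD !big_map /= mulr_sumr -sumrB; apply: eq_bigr => p _.
by rewrite !hornerD !hornerZ; ring.
Qed.

Lemma iter_expsumD_shift b l n : iter n expsumD (expsum_shift b l) = expsum_shift b (iter n expsumD l).
Proof.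
elim: n => [//|n ih]; rewrite !iterS ih /expsumD /expsum_shift -!map_comp.
apply: eq_map => p /=; congr pair.
by rewrite !derivD !derivZ !scalerDr !scalerA [_ * p.2]mulrC; ring.
Qed.

Lemma size_deriv_add (K : fieldType) (a : K) (p : {poly K}) :
  (size (p^`() + a *: p)%R <= size p)%N.
Proof.
rewrite (leq_trans (size_polyD _ _))// geq_max size_scale_leq andbT.
by have [->|p0] := eqVneq p 0; [rewrite deriv0|rewrite ltnW// lt_size_deriv].
Qed.

(** The decreasing measure of two inductions, for flat complex sums and for real zeros: at the
    frequency b the coefficient becomes its derivative, and no other one grows. *)
Lemma size_deriv_shift_sum (K : fieldType) (l : seq ({poly K} * K)) b p0 :
  (p0, b) \in l -> p0 != 0 ->
  (\sum_(p <- [seq (p.1^`() + (p.2 - b) *: p.1, p.2)%R | p <- l]) size p.1 <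
   \sum_(p <- l) size p.1)%N.
Proof.
move=> pl p00; rewrite big_map /= !(big_rem _ pl) /= subrr scale0r addr0.
rewrite -addSn leq_add//; first exact: lt_size_deriv.
by apply: leq_sum => p _; exact: size_deriv_add.
Qed.

(* [D - b] lowers the degree of the coefficient at the frequency [b]. *)
Lemma expsum_flat_eq0 l (k : C) :
  (forall j, expsum (iter j expsumD l) k = 0) -> forall z, expsum l z = 0.
Proof.
have [n] := ubnP (\sum_(p <- l) size p.1)%N.
elim: n l => // n ih l ln lk z.
have [/hasP[[p0 b] pl /= p00]|/hasPn l0] := boolP (has (fun p => p.1 != 0) l).
  have S0 : forall w, expsum (expsum_shift b l) w = 0.
    apply: ih; first exact: leq_trans (size_deriv_shift_sum pl p00) _.
    by move=> j; rewrite iter_expsumD_shift expsum_shiftE -iterS !lk mulr0 subr0.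
  (* (D - b) kills the sum by induction, so its product with [cexp (- b * w)] is constant, with the
     value 0 at [k]. *)
  have : cexp (- b * z) * expsum l z = cexp (- b * k) * expsum l k.
    apply: (is_derive0_const (h := fun w => cexp (- b * w) * expsum l w)) => w.
    have d1 := is_derive_cexpM (- b) w; have d2 := is_derive_expsum l w.
    have -> : (fun w => cexp (- b * w) * expsum l w) =
      ((fun w => cexp (- b * w)) * expsum l :> (C -> C)) by [].
    apply: is_derive_eq; rewrite /GRing.scale /=.
    have /eqP := S0 w; rewrite expsum_shiftE subr_eq0 => /eqP ->; ring.
  move/eqP; rewrite (lk 0%N) mulr0 mulf_eq0 (negbTE (cexp_neq0 _)).
  by move/eqP.
rewrite /expsum big_seq big1// => p /l0; rewrite negbK => /eqP ->.
by rewrite horner0 mul0r.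
Qed.

Definition zero_order l (k : C) (m : nat) :=
  (forall j, (j < m)%N -> expsum (iter j expsumD l) k = 0) /\
  expsum (iter m expsumD l) k != 0.

(** A point where all derivatives vanish would make the sum vanish identically. Hence no
    multiplicity is infinite. *)
Lemma zero_order_ex l (k z : C) : expsum l z != 0 -> exists m, zero_order l k m.
Proof.
move=> lz; have ex : exists m, expsum (iter m expsumD l) k != 0.
  apply: contrapT => /forallNP H; move/eqP: lz; apply.
  apply: (@expsum_flat_eq0 l k) => j; have /negP := H j.
  by rewrite negbK => /eqP.
exists (ex_minn ex); case: ex_minnP => m mk min; split=> // j jm.
by apply/eqP; apply: contraTT jm => /min; rewrite -leqNgt.
Qed.

Lemma zero_mult_expsum l (k : C) m : zero_order l k m -> zero_mult (expsum l) k = m%:R%:E.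
Proof.
move=> [lk mk]; rewrite /zero_mult; apply/eqP; rewrite eq_le; apply/andP; split.
  apply: ge_ereal_sup => _ [n /= nH <-]; rewrite lee_fin ler_nat leqNgt.
  apply/negP => mn; have := nH m mn; rewrite derive1n_expsum => /eqP.
  by apply/negP.
apply: ereal_sup_ubound; exists m => // j jm.
by rewrite derive1n_expsum lk.
Qed.

End ZeroOrder.

(** * Real exponential sums *)

Section RealExponentialPolynomials.
Context {R : realType}.
Implicit Type l : seq ({poly R} * R).

Definition rexpsum l (y : R) : R := \sum_(p <- l) p.1.[y] * expR (p.2 * y).

Lemma is_derive_expR_mull (b y : R) :
  is_derive y 1 (fun x : R => expR (b * x)) (b * expR (b * y)).
Proof.
have d1 : is_derive y 1 (fun x : R => b * x) b.
  have -> : (fun x : R => b * x) = b *: (id : R -> R) by [].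
  by apply: is_derive_eq; rewrite /GRing.scale /= mulr1.
have d2 := is_derive1_comp (is_derive_expR (b * y)) d1.
by apply: is_derive_eq; rewrite mulrC.
Qed.

Lemma is_derive_rexpsum l (y : R) : is_derive y 1 (rexpsum l)
  (rexpsum [seq (p.1^`() + p.2 *: p.1, p.2) | p <- l] y).
Proof.
elim: l => [|[p b] l ih].
  have -> : rexpsum [::] = cst 0 by apply/funext => x; rewrite /rexpsum big_nil.
  exact: is_derive_cst.
have -> : rexpsum ((p, b) :: l) =
    (horner p * (fun x => expR (b * x)) + rexpsum l :> (R -> R)).
  by apply/funext => x; rewrite /rexpsum big_cons.
have h1 := is_derive_poly p y; have h2 := is_derive_expR_mull b y.
apply: is_derive_eq; rewrite [in RHS]/rexpsum /= big_cons /= -/(rexpsum _ _).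
rewrite hornerD hornerZ /GRing.scale /=; ring.
Qed.

Lemma rolle_seq (f df : R -> R) (x : R) (s : seq R) :
  (forall y : R, is_derive y 1 f (df y)) ->
  path <%R x s -> all (fun y => f y == 0) (x :: s) ->
  exists t, [/\ size t = size s, path <%R x t & all (fun y => df y == 0) t].
Proof.
move=> fdf; elim: s x => [|y s ih] x; first by exists [::].
move=> /= /andP[xy ys] /and3P[/eqP fx /eqP fy fs].
have [|t [ts yt dt]] := ih y ys; first by rewrite /= fy eqxx.
have [|||c cxy dc] := @Rolle R f x y xy.
- by move=> z _; exact: (ex_derive (is_derive := fdf z)).
- apply: derivable_within_continuous => z _.
  exact: (ex_derive (is_derive := fdf z)).
- by rewrite fx fy.
move: cxy; rewrite in_itv /= => /andP[xc cy].
exists (c :: t); split; rewrite /= ?ts//.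
  rewrite xc /=; case: t yt {ts dt} => //= a t /andP[ya ->].
  by rewrite (lt_trans cy ya).
rewrite dt andbT; apply/eqP.
by have := fdf c => /(@derive_val _ _ _ _ _ _ _) <-; exact: (derive_val (is_derive := dc)).
Qed.

(* Pólya's argument: multiply by [expR (- b y)] and differentiate, so that
   Rolle's theorem trades one zero for one degree. *)
Lemma rexpsum_zeros_eq0 l (s : seq R) :
  (\sum_(p <- l) size p.1 <= size s)%N -> sorted <%R s ->
  all (fun y => rexpsum l y == 0) s -> forall y, rexpsum l y = 0.
Proof.
move: {-2}(size s) (erefl (size s)) => n.
elim: n l s => [|n ih] l s ns ln ss s0 y.
  have [/hasP[p pl p0]|/hasPn l0] := boolP (has (fun p => p.1 != 0) l).
    move: ln; rewrite (big_rem _ pl) /= leqn0 addn_eq0 size_poly_eq0.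
    by rewrite (negbTE p0).
  rewrite /rexpsum big_seq big1// => p /l0; rewrite negbK => /eqP ->.
  by rewrite horner0 mul0r.
have [/hasP[[p0 b] pl /= p00]|/hasPn l0] := boolP (has (fun p => p.1 != 0) l);
    last first.
  rewrite /rexpsum big_seq big1// => p /l0; rewrite negbK => /eqP ->.
  by rewrite horner0 mul0r.
case: s ns ss s0 => // x s [ns] ss s0.
pose L := [seq (p.1^`() + (p.2 - b) *: p.1, p.2) | p <- l].
pose h (z : R) := expR (- b * z) * rexpsum l z.
have hd (z : R) : is_derive z 1 h (expR (- b * z) * rexpsum L z).
  have d1 := is_derive_expR_mull (- b) z; have d2 := is_derive_rexpsum l z.
  have -> : h = ((fun w => expR (- b * w)) * rexpsum l :> (R -> R)) by [].
  apply: is_derive_eq; rewrite /GRing.scale /= /L.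
  have -> : rexpsum [seq (p.1^`() + (p.2 - b) *: p.1, p.2) | p <- l] z =
      rexpsum [seq (p.1^`() + p.2 *: p.1, p.2) | p <- l] z - b * rexpsum l z.
    rewrite /rexpsum !big_map /= mulr_sumr -sumrB; apply: eq_bigr => p _.
    by rewrite !hornerD !hornerZ; ring.
  ring.
have [|t [ts xt dt]] := rolle_seq hd (x := x) (s := s) ss.
  by apply: sub_all s0 => z /eqP z0; rewrite /h z0 mulr0.
have L0 : forall z, rexpsum L z = 0.
  apply: (ih _ t); rewrite ?ts//.
  - by rewrite -ltnS (leq_trans _ ln)// (size_deriv_shift_sum pl p00).
  - by case: t xt {ts dt} => //= a t /andP[].
  - apply: sub_all dt => z /=.
    by rewrite mulf_eq0 gt_eqF ?expR_gt0.
(* The derivative of [h] vanishes identically, so [h] is constant; it is 0 at the zero [x]. *)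
have hc : h y = h x.
  apply/eqP; rewrite -subr_eq0; apply/eqP.
  wlog xy : x y {s0 ss xt} / x <= y.
    move=> H; case: (leP x y) => [/H//|/ltW/H hh].
    by rewrite -opprB hh oppr0.
  have [|c _ ->] := @MVT_segment R h (fun z => expR (- b * z) * rexpsum L z) x y xy
    (fun z _ => hd z).
  - apply: derivable_within_continuous => z _.
    exact: (ex_derive (is_derive := hd z)).
  - by rewrite L0 mulr0 mul0r.
move: hc; rewrite /h; have /andP[/eqP -> _] := s0; rewrite mulr0 => /eqP.
by rewrite mulf_eq0 gt_eqF ?expR_gt0// => /eqP.
Qed.

(** After each point found, the intermediate value theorem is applied on the interval that remains,
    so the points increase and are distinct. *)
Lemma ivt_seq (th : R -> R) (a b : R) (vs : seq R) :
  a <= b -> (forall x, a <= x <= b -> {for x, continuous th}) ->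
  path <%R (th a) vs -> all (fun v => v < th b) vs ->
  exists ys, [/\ path <%R a ys, all (fun y => y <= b) ys &
    [seq th y | y <- ys] = vs].
Proof.
elim: vs a => [|v vs ih] a ab cth /=; first by exists [::].
move=> /andP[av vvs] /andP[vb vsb].
have [||c] := @IVT R th a b v ab.
- apply: continuous_in_subspaceT => x; rewrite inE /= in_itv /=; exact: cth.
- by rewrite ge_min le_max (ltW av) (ltW vb) orbT.
rewrite in_itv /= => /andP[ac cb] cv.
have ac' : a < c.
  rewrite lt_neqAle ac andbT; apply: contraTneq av => ->.
  by rewrite cv ltxx.
have [|||ys [cys ysb <-]] := ih c cb; rewrite ?cv//.
  by move=> x /andP[cx xb]; apply: cth; rewrite (le_trans ac cx).
by exists (c :: ys); rewrite /= ac' cys cv cb.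
Qed.

Lemma cos_next_zero (x : R) : exists u, [/\ x < u, u <= x + pi & cos u = 0].
Proof.
have p0 := pi_gt0 R.
have [x0|x0] := eqVneq (cos x) 0.
  by exists (x + pi); rewrite ltrDl p0 lexx cosDpi x0 oppr0.
have xp : x <= x + pi by rewrite lerDl ltW.
have [||c] := @IVT R cos x (x + pi) 0 xp.
- apply: continuous_in_subspaceT => y _; exact: continuous_cos.
- rewrite cosDpi ge_min le_max; have [] := leP (cos x) 0; rewrite oppr_ge0 oppr_le0 => h; rewrite ?h ?orbT//.
  by rewrite (ltW h) orbT.
rewrite in_itv /= => /andP[xc cp] c0; exists c; split => //.
by rewrite lt_neqAle xc andbT; apply: contra_neq x0 => ->.
Qed.

(* Each crossing of [pi / 2 + pi Z] by a continuous argument is a zero of the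
   real part. *)
Lemma rexpsum_arg_variation_le l (rho th : R -> R) (a b : R) : a <= b ->
  (forall x, a <= x <= b -> {for x, continuous th}) ->
  (forall x, a <= x <= b -> 0 < rho x) ->
  (forall x, a <= x <= b -> rexpsum l x = rho x * cos (th x)) ->
  `|th b - th a| <= pi * (\sum_(p <- l) size p.1).+1%:R.
Proof.
move En : (\sum_(p <- l) size p.1)%N => n ab.
wlog thab : th / th a <= th b.
  move=> H cth rho0 rpE; case: (leP (th a) (th b)) => [/H|/ltW ba]; first exact.
  rewrite distrC; have -> : th a - th b = - th b - - th a by ring.
  apply: (H (fun x => - th x)) => //; first by rewrite lerN2.
    by move=> x /cth ?; apply: continuousN.
  by move=> x /rpE ->; rewrite cosN.
move=> cth rho0 rpE; rewrite ger0_norm ?subr_ge0// leNgt; apply/negP => lt.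
have p0 := pi_gt0 R.
have [u [au ua u0]] := cos_next_zero (th a).
have uE i : cos (u + pi *+ i) = 0 by rewrite (alternatingn (@cosDpi R)) u0 mulr0.
(* As [u <= th a + pi], a variation above [pi * n.+1] leaves room below [th b] for these [n] zeros
   of cos, enough to force the sum to vanish identically. *)
pose vs : seq R := [seq (u + pi *+ i : R) | i <- iota 0 n].
have vsP (P : pred R) : (forall i, (i < n)%N -> P (u + pi *+ i)) -> all P vs.
  by move=> H; rewrite all_map; apply/allP => i; rewrite mem_iota => /H.
have vs0 (v : R) : v \in vs -> cos v = 0.
  have /allP H : all (fun v => cos v == 0) vs.
    by apply: vsP => i _; rewrite uE.
  by move=> /H /eqP.
have vsb : all (fun v => v < th b) vs.
  apply: vsP => i iN.
  rewrite (le_lt_trans (lerD ua (lexx _)))//.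
  move: lt; rewrite ltrBrDl; apply: le_lt_trans; rewrite -addrA lerD2l.
  by rewrite -mulrS -[leLHS]mulr_natr ler_pM2l// ler_nat; exact: ltnW.
have avs : path <%R (th a) vs.
  rewrite (@path_sortedE _ <%R lt_trans); apply/andP; split.
    apply: vsP => i _.
    by rewrite (lt_le_trans au)// lerDl mulrn_wge0// ltW.
  rewrite sorted_map; apply: (@sub_sorted _ ltn); last exact: iota_ltn_sorted.
  by move=> i j ij; rewrite /= ltrD2l ltr_pMn2l.
have [ys [ays ysb ysE]] := ivt_seq ab cth avs vsb.
have F0 : forall y, rexpsum l y = 0.
  apply: (@rexpsum_zeros_eq0 l ys).
  - by rewrite En -(size_map th) ysE size_map size_iota.
  - by case: (ys) ays => //= y ys' /andP[].
  - apply/allP => y yys; rewrite rpE; last first.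
      rewrite (allP ysb _ yys) andbT ltW//.
      exact: (allP (order_path_min lt_trans ays)).
    by rewrite vs0 ?mulr0// -ysE map_f.
have cos0 x : a <= x <= b -> cos (th x) = 0.
  move=> xab; have /eqP := F0 x; rewrite rpE// mulf_eq0 gt_eqF ?rho0//.
  by move/eqP.
(* The contradiction: cos (th x) is 0 on all of [a, b], yet [th] takes the value u + pi / 2 or u -
   pi / 2, where cos is not 0. The position of [u] decides which of the two lies in range. *)
have [w [aw wb w0]] : exists w, [/\ th a <= w, w <= th b & cos w != 0].
  have su : sin u != 0.
    have : sin u ^+ 2 != 0 by rewrite sin2cos2 u0 expr0n subr0 oner_eq0.
    by rewrite expf_eq0.
  have thp : th a + pi <= th b.
    rewrite -lerBrDl (le_trans _ (ltW lt))// ler_peMr ?(ltW p0)//.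
    by rewrite ler1n.
  have [uh|uh] := leP u (th a + pi / 2).
    exists (u + pi / 2); rewrite cosDpihalf oppr_eq0 su.
    by split=> //; move: au uh thp p0; lra.
  exists (u - pi / 2); rewrite cosBpihalf su.
  by split=> //; move: au uh thp p0 ua; lra.
have [||x] := @IVT R th a b w ab.
- apply: continuous_in_subspaceT => x; rewrite inE /= in_itv /=; exact: cth.
- by rewrite ge_min le_max aw wb orbT.
by rewrite in_itv /= => xab xw; rewrite -xw cos0 ?eqxx in w0.
Qed.

End RealExponentialPolynomials.

(** * Continuous arguments *)

Section Lifting.
Context {R : realType}.
Local Notation C := R[i].
Local Notation nrm := (@Normc.normc R).

Definition cis (t : R) : C := cos t +i* sin t.

Lemma cisD (a b : R) : cis (a + b) = cis a * cis b.
Proof.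
apply/eqP; rewrite eq_complex /= sinD cosD; apply/andP; split; apply/eqP => //.
by ring.
Qed.

Lemma cis0 : cis 0 = 1.
Proof. by rewrite /cis cos0 sin0. Qed.

Lemma nrm_cis (a : R) : nrm (cis a) = 1.
Proof. by rewrite /= cos2Dsin2 sqrtr1. Qed.

Lemma cis_inj (a b : R) : cis a = cis b -> `|a - b| < 2 * pi -> a = b.
Proof.
move=> ab lt; apply/eqP; rewrite -subr_eq0; apply/eqP.
have : cis (a - b) = 1 by rewrite cisD ab -cisD subrr cis0.
move: (a - b) lt => {ab}x xlt [cx _].
have sx : sin (x / 2) = 0.
  have : cos (x / 2 *+ 2) = 1 by rewrite -mulr_natr divfK.
  rewrite cos_mulr2n cos2sin2 mulr2n => h.
  have /eqP : sin (x / 2) ^+ 2 = 0 by move: h; lra.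
  by rewrite expf_eq0 /= => /eqP.
apply/eqP; apply: contraT => x0.
have : 0 < sin (`|x| / 2).
  by apply: sin_gt0_pi; rewrite divr_gt0 ?normr_gt0//= ltr_pdivrMr// mulrC.
case: (ger0P x) => _; first by rewrite sx ltxx.
by rewrite mulNr sinN sx oppr0 ltxx.
Qed.

(** Meant for the right half plane, where it is the continuous branch with values in (- pi / 2, pi /
    2). *)
Definition arg (z : C) : R := atan (Im z / Re z).

Lemma arg_gt (z : C) : - (pi / 2) < arg z.
Proof. exact: atan_gtNpi2. Qed.

Lemma arg_lt (z : C) : arg z < pi / 2.
Proof. exact: atan_ltpi2. Qed.

Lemma argE (z : C) : 0 < Re z -> z = (nrm z)%:C * cis (arg z).
Proof.
case: z => x y /= x0; rewrite /arg /cis /=.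
set q := y / x.
have sq : 0 < Num.sqrt (1 + q ^+ 2) by rewrite sqrtr_gt0 ltr_pwDl ?sqr_ge0.
have nE : Num.sqrt (x ^+ 2 + y ^+ 2) = x * Num.sqrt (1 + q ^+ 2).
  rewrite -[in RHS](ger0_norm (ltW x0)) -sqrtr_sqr -sqrtrM ?sqr_ge0//.
  by congr Num.sqrt; rewrite /q; field; rewrite gt_eqF.
have sE : sin (atan q) = q * cos (atan q).
  have c0 : cos (atan q) != 0 by rewrite cos_atan invr_eq0 gt_eqF.
  by rewrite -[X in _ = X * _]atanK /tan divfK.
apply/eqP; rewrite eq_complex /= nE sE cos_atan !mul0r subr0 addr0.
apply/andP; split; apply/eqP.
  by field; rewrite gt_eqF.
by rewrite /q; field; rewrite !gt_eqF.
Qed.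

Lemma continuous_arg (z : C) : 0 < Re z -> {for z, continuous arg}.
Proof.
move=> z0; apply: (@continuous_comp _ _ _ (fun w : C => Im w / Re w) atan).
  apply: continuousM; first exact: continuous_Im.
  by apply: continuousV; [rewrite gt_eqF|exact: continuous_Re].
exact: continuous_atan.
Qed.

Lemma phase_ex (z : C) : z != 0 -> exists a, z = (nrm z)%:C * cis a.
Proof.
move=> z0; have [x0|x0|x0] := ltgtP (Re z) 0.
- exists (pi + arg (- z)); have /argE : 0 < Re (- z) by rewrite ReNc oppr_gt0.
  rewrite nrmN cisD => zE; rewrite -[LHS]opprK {1}zE.
  have -> : cis pi = -1.
    by apply/eqP; rewrite eq_complex /= cospi sinpi oppr0 !eqxx.
  by ring.
- by exists (arg z); exact: argE.
- case: z z0 x0 => x y + /= x0; rewrite x0 eq_complex /= eqxx /= => y0.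
  have ny : Num.sqrt (0 ^+ 2 + y ^+ 2) = `|y| by rewrite expr0n add0r sqrtr_sqr.
  case: (ltgtP y 0) y0 => // y0 _.
    exists (- (pi / 2)); apply/eqP; rewrite eq_complex /= ny ltr0_norm//.
    by rewrite cosN sinN cos_pihalf sin_pihalf; apply/andP; split; apply/eqP; ring.
  exists (pi / 2); apply/eqP; rewrite eq_complex /= ny gtr0_norm//.
  by rewrite cos_pihalf sin_pihalf; apply/andP; split; apply/eqP; ring.
Qed.

(** A relation, because arguments are determined only modulo 2 pi and different branches are used on
    different sides. For w = 0 every t qualifies. *)
Definition is_arg (w : C) (t : R) := w = (nrm w)%:C * cis t.

Lemma is_argM (w v : C) (s t : R) :
  is_arg w s -> is_arg v t -> is_arg (w * v) (s + t).
Proof.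
rewrite /is_arg => ws vt; rewrite {1}ws {1}vt cisD nrmM rmorphM /=; ring.
Qed.

Lemma is_arg1 : is_arg 1 0.
Proof. by rewrite /is_arg nrm1 cis0 mulr1. Qed.

Lemma is_argX (w : C) (t : R) n : is_arg w t -> is_arg (w ^+ n) (n%:R * t).
Proof.
move=> wt; elim: n => [|n ih]; first by rewrite mul0r expr0; exact: is_arg1.
by rewrite exprS -natr1 mulrDl mul1r addrC; exact: is_argM.
Qed.

Lemma is_arg_prod_in (I : eqType) (s : seq I) (F : I -> C) (T : I -> R) :
  (forall i, i \in s -> is_arg (F i) (T i)) ->
  is_arg (\prod_(i <- s) F i) (\sum_(i <- s) T i).
Proof.
elim: s => [|i s ih] FT; first by rewrite !big_nil; exact: is_arg1.
rewrite !big_cons; apply: is_argM; first by apply: FT; rewrite mem_head.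
by apply: ih => j js; apply: FT; rewrite in_cons js orbT.
Qed.

(** The quotient lies in the open disc of radius 1 about 1. *)
Lemma Re_div_gt0 (a b : C) : nrm (a - b) < nrm b -> 0 < Re (a / b).
Proof.
move=> ab; have b0 : b != 0 by rewrite -nrm_gt0 (le_lt_trans (nrm_ge0 _) ab).
have -> : a / b = 1 + (a - b) / b by field.
rewrite ReDc /= -ltrBlDl sub0r.
have : `|Re ((a - b) / b)| < 1.
  rewrite (le_lt_trans (Re_le_nrm _))// nrmM nrmV ltr_pdivrMr ?nrm_gt0//.
  by rewrite mul1r.
by rewrite ltr_norml => /andP[].
Qed.

(** Compactness of K x [0, 1] gives one subdivision of [0, 1] that serves all z. A relative change
    below 1 keeps the quotients of successive values in the right half plane, where [arg] is
    continuous. *)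
Lemma star_near_step (g : C -> C) (K : set C) :
  compact K -> (forall z (t : R), K z -> 0 <= t <= 1 -> K (t%:C * z)) ->
  continuous g -> (forall z, K z -> g z != 0) ->
  exists n : nat, forall z (s t : R), K z -> 0 <= t <= 1 ->
    `|s - t| <= n.+1%:R^-1 -> nrm (g (s%:C * z) - g (t%:C * z)) < nrm (g (t%:C * z)).
Proof.
move=> cK Kstar cg gK.
have cKI : compact (K `*` `[0 : R, 1]%classic).
  by apply: compact_setX => //; exact: segment_compact.
have NC := (compact_near_coveringP _).1 cKI.
have [|N _ NP] := NC nat \oo (fun n (p : C * R) => forall s : R,
    `|s - p.2| <= n.+1%:R^-1 ->
    nrm (g (s%:C * p.1) - g (p.2%:C * p.1)) < nrm (g (p.2%:C * p.1))) _;
  last first.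
- exists N => z s t Kz t01.
  by apply: (NP N (leqnn N) (z, t)); split => //=; rewrite in_itv.
- move=> [z0 t0] [/= Kz0]; rewrite in_itv /= => t01.
  set c := g (t0%:C * z0); have c0 : 0 < nrm c by rewrite nrm_gt0 gK//; exact: Kstar.
  have /cvg_nrmP/(_ _ (divr_gt0 c0 (ltr0Sn R 3)))/nbhs_nrmP[r r0 rg] :
    g w @[w --> t0%:C * z0] --> c by exact: cg.
  (* |s z - t0 z0| <= 2 d (|z0| + 1) + d < r by this choice. Two values within |c| / 4 of c differ
     by less than |c| / 2, and each exceeds 3 |c| / 4 in modulus. *)
  pose d := Num.min 1 (r / (2 * nrm z0 + 4)).
  have D0 : 0 < 2 * nrm z0 + 4 by rewrite ltr_wpDl// mulr_ge0// nrm_ge0.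
  have d0 : 0 < d by rewrite lt_min ltr01 divr_gt0.
  have d1 : d <= 1 by rewrite ge_min lexx.
  have dr : d * (2 * nrm z0 + 4) <= r.
    by rewrite -ler_pdivlMr// ge_min lexx orbT.
  have gs (s : R) z : nrm (z - z0) < d -> `|s - t0| < 2 * d ->
      nrm (c - g (s%:C * z)) < nrm c / 4.
    move=> zd sd; apply: rg.
    have -> : s%:C * z - t0%:C * z0 = (s - t0)%:C * z + t0%:C * (z - z0).
      by rewrite rmorphB /=; ring.
    rewrite (le_lt_trans (nrmD _ _))// !nrmM !nrmC.
    have zz : nrm z <= nrm z0 + 1.
      have -> : z = z0 + (z - z0) by ring.
      by rewrite (le_trans (nrmD _ _))// lerD2l (le_trans (ltW zd)).
    have t1 : `|t0| <= 1 by rewrite ger0_norm; case/andP: t01.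
    have A : `|s - t0| * nrm z <= 2 * d * (nrm z0 + 1).
      by rewrite ler_pM ?nrm_ge0 ?(ltW sd).
    have B : `|t0| * nrm (z - z0) <= 1 * d.
      by rewrite ler_pM ?nrm_ge0 ?(ltW zd).
    apply: lt_le_trans dr; move: A B d0; nra.
  exists ([set p : C * R | nrm (p.1 - z0) < d /\ `|p.2 - t0| < d],
          [set n : nat | n.+1%:R^-1 < d]); last first.
    move=> [[z t] n] /= [[zd td] nd] s st.
    have A : nrm (c - g (t%:C * z)) < nrm c / 4.
      by apply: gs => //; rewrite (lt_trans td)// ltr_pMl// ltr1n.
    have B : nrm (c - g (s%:C * z)) < nrm c / 4.
      apply: gs => //; have -> : s - t0 = (s - t) + (t - t0) by ring.
      rewrite (le_lt_trans (ler_normD _ _))// mulr_natl mulr2n ltrD//.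
      exact: le_lt_trans st nd.
    have E : nrm (g (s%:C * z) - g (t%:C * z)) < nrm c / 4 + nrm c / 4.
      have -> : g (s%:C * z) - g (t%:C * z) =
        (g (s%:C * z) - c) + (c - g (t%:C * z)) by ring.
      by rewrite (le_lt_trans (nrmD _ _))// ltrD// nrmB.
    have F := nrm_dist c (c - g (t%:C * z)).
    rewrite (_ : c - (c - g (t%:C * z)) = g (t%:C * z)) in F; last by ring.
    by move: A E F c0; lra.
  split => /=.
    exists ([set z | nrm (z - z0) < d], [set t : R | `|t - t0| < d]) => //=.
    split; first by apply/nbhs_nrmP; exists d.
    apply/nbhs_ballP; exists d => //= t.
    by rewrite /ball /= distrC.
  exact: near_infty_natSinv_lt (PosNum d0).
Unshelve. all: by exact: nbhs_filter.
Qed.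

(* The argument of [g z] is that of [g 0] plus the small increments along a fine
   subdivision of the segment from 0 to z; as the subdivision does not depend on
   z, this is continuous in z. *)
Lemma star_lift (g : C -> C) (K : set C) :
  compact K -> (forall z (t : R), K z -> 0 <= t <= 1 -> K (t%:C * z)) ->
  K 0 -> continuous g -> (forall z, K z -> g z != 0) ->
  exists th : C -> R, forall z, K z ->
    {for z, continuous th} /\ is_arg (g z) (th z).
Proof.
move=> cK Kstar K0 cg gK.
have [n step] := star_near_step cK Kstar cg gK.
have [a0 a0E] := phase_ex (gK _ K0).
pose t k : R := k%:R / n.+1%:R.
pose q k (z : C) := g ((t k.+1)%:C * z) / g ((t k)%:C * z).
pose th m z := a0 + \sum_(k < m) arg (q k z).
have t01 k : (k <= n.+1)%N -> 0 <= t k <= 1.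
  move=> kn; rewrite /t divr_ge0//= ler_pdivrMr ?ltr0Sn// mul1r ler_nat//.
have q0 k z : (k <= n)%N -> K z -> 0 < Re (q k z).
  move=> kn Kz; apply/Re_div_gt0/step => //; first exact/t01/ltnW.
  rewrite /t -mulrBl -natrB// subSnn mul1r ger0_norm//.
have gnz k z : (k <= n.+1)%N -> K z -> g ((t k)%:C * z) != 0.
  by move=> kn Kz; apply/gK/Kstar => //; exact: t01.
exists (th n.+1) => z Kz; split; last first.
  suff H m : (m <= n.+1)%N -> is_arg (g ((t m)%:C * z)) (th m z).
    by have := H _ (leqnn _); rewrite /t divff ?pnatr_eq0// mul1r.
  elim: m => [_|m ih mn].
    by rewrite /t mul0r mul0r /th big_ord0 addr0.
  rewrite /th big_ord_recr /= addrA -/(th m z).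
  have -> : g ((t m.+1)%:C * z) = g ((t m)%:C * z) * q m z.
    by rewrite /q [RHS]mulrC divfK// gnz// ltnW.
  apply: is_argM; first exact/ih/ltnW.
  exact/argE/q0.
apply: continuousD; first exact: cst_continuous.
have cgt k : {for z, continuous (fun w => g ((t k)%:C * w))}.
  apply: (@continuous_comp _ _ _ (fun w : C => (t k)%:C * w) g); last exact: cg.
  exact: mulrl_continuous.
apply: continuous_sum_for => -[k kn] _.
apply: (@continuous_comp _ _ _ (q k) arg).
  apply: continuousM; first exact: cgt.
  by apply: continuousV; [apply: gnz => //; exact: ltnW|exact: cgt].
exact/continuous_arg/q0.
Qed.

(* The branch of the argument with values within [pi / 2] of [c]. *)
Definition arg_from (c : R) (w : C) : R := c + arg (w * cis (- c)).

Lemma is_arg_from (c : R) (w : C) : 0 < Re (w * cis (- c)) ->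
  is_arg w (arg_from c w).
Proof.
move=> /argE; rewrite nrmM nrm_cis mulr1 => wE.
rewrite /is_arg /arg_from cisD mulrCA -wE mulrCA -cisD subrr cis0 mulr1 //.
Qed.

(** The two values are arguments of the same number and differ by less than 3 pi / 2, hence agree.
    This glues the branches of adjacent sides at a corner of the rectangle. *)
Lemma arg_from_corner (c : R) (w : C) : 0 < Re (w * cis (- c)) ->
  0 < Re (w * cis (- (c + pi / 2))) -> arg_from (c + pi / 2) w = arg_from c w.
Proof.
move=> h1 h2; have := is_arg_from h2; have := is_arg_from h1.
have w0 : (nrm w)%:C != 0.
  rewrite -normc_nrm normr_eq0; apply: contraTneq h1 => ->.
  by rewrite mul0r ltxx.
rewrite /is_arg => w1; rewrite {1}w1 => /(mulfI w0)/esym/cis_inj; apply.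
rewrite /arg_from.
have := arg_gt (w * cis (- c)); have := arg_lt (w * cis (- c)).
have := arg_gt (w * cis (- (c + pi / 2))).
have := arg_lt (w * cis (- (c + pi / 2))); have := pi_gt0 R.
by rewrite ltr_norml => *; apply/andP; split; lra.
Qed.

Lemma continuous_arg_from (c : R) (k z : C) : 0 < Re ((z - k) * cis (- c)) ->
  {for z, continuous (fun w => arg_from c (w - k))}.
Proof.
move=> h; apply: continuousD; first exact: cst_continuous.
apply: (@continuous_comp _ _ _ (fun w : C => (w - k) * cis (- c)) arg).
  apply: continuousM; last exact: cst_continuous.
  by apply: continuousB; [exact: cvg_id|exact: cst_continuous].
exact: continuous_arg.
Qed.

End Lifting.

(** * Generic configurations *)

Section Configurations.
Context {R : realType} {N : nat}.
Implicit Types (Y Z : config R N) (s t : 'S_N) (i j : 'I_N).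

(* How often the unordered pair {i, j} is used by [s], counting both
   orientations. *)
Definition edge s i j : nat := ((s i == j) + (s j == i))%N.

Definition perm_size s Y : R := \sum_(j < N) l2norm (Y j - Y (s j)).

Definition edges_differ s t :=
  [exists i, exists j, (i != j) && (edge s i j != edge t i j)].

(** Only accidental coincidences are excluded: when s and t use every pair equally often, their
    sizes agree for all configurations. *)
Definition generic_config : set (config R N) :=
  [set Y | forall s t, edges_differ s t -> perm_size s Y != perm_size t Y].

Lemma l2normB (n : nat) (x y : 'rV[R]_n) : `|l2norm x - l2norm y| <= l2norm (x - y).
Proof.
have H (u v : 'rV[R]_n) : l2norm u - l2norm v <= l2norm (u - v).
  by rewrite lerBlDr (le_trans _ (l2normD _ _))// subrK.
by rewrite ler_norml H andbT lerNl opprB -[l2norm (x - y)]l2normN opprB H.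
Qed.

Lemma l2norm_le_config_dist Y Z j : l2norm (Y j - Z j) <= config_dist Y Z.
Proof.
rewrite -[leLHS]ger0_norm ?l2norm_ge0// -sqrtr_sqr ler_wsqrtr//.
rewrite (bigD1 j)//= lerDl; apply: sumr_ge0 => i _; exact: sqr_ge0.
Qed.

Lemma config_dist_le Y Z (e : R) : 0 <= e ->
  (forall j, l2norm (Y j - Z j) <= e) -> config_dist Y Z <= N%:R * e.
Proof.
move=> e0 H.
have Ne : 0 <= N%:R * e by rewrite mulr_ge0.
rewrite -[leRHS]ger0_norm// -sqrtr_sqr ler_wsqrtr//.
rewrite (@le_trans _ _ (\sum_(j < N) e ^+ 2))//.
  by apply: ler_sum => j _; rewrite lerXn2r ?nnegrE ?l2norm_ge0.
rewrite sumr_const card_ord exprMn -[leLHS]mulr_natl ler_wpM2r ?sqr_ge0//.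
by rewrite -natrX ler_nat; case: (N) => // n; rewrite -mulnn leq_pmulr.
Qed.

Lemma nbhs_configP Y (A : set (config R N)) :
  nbhs Y A <-> exists2 e : R, 0 < e & forall Z, config_dist Y Z < e -> A Z.
Proof.
by split=> [/nbhs_ballP[e /= e0 H]|[e e0 H]];
  [exists e|apply/nbhs_ballP; exists e].
Qed.

Lemma continuous_perm_size s : continuous (perm_size s : config R N -> R).
Proof.
move=> Y; apply: continuous_sum_for => j _.
apply/(cvgrPdist_le (FF := nbhs_filter Y)) => e e0.
apply/nbhs_configP; exists (e / 2); first by rewrite divr_gt0.
move=> Z YZ; rewrite (le_trans (l2normB _ _))//.
have -> : Y j - Y (s j) - (Z j - Z (s j)) =
  (Y j - Z j) + - (Y (s j) - Z (s j)) by rewrite !opprD !opprK addrACA.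
rewrite (le_trans (l2normD _ _))// l2normN [leRHS]splitr lerD//.
  exact: le_trans (l2norm_le_config_dist _ _ _) (ltW YZ).
exact: le_trans (l2norm_le_config_dist _ _ _) (ltW YZ).
Qed.

(** * Openness and density of the generic configurations *)

Lemma open_perm_size_neq s t :
  open [set Y : config R N | perm_size s Y != perm_size t Y].
Proof.
have -> : [set Y : config R N | perm_size s Y != perm_size t Y] =
    (fun Y => perm_size s Y - perm_size t Y) @^-1` [set x | x != 0].
  by apply/seteqP; split => Y /=; rewrite subr_eq0.
apply: open_comp; last exact: open_neq.
by move=> Y _; apply: continuousB; exact: continuous_perm_size.
Qed.

(** Reads off the multiplicity of one edge; it is applied to the mixed differences of the distances
    |Y a - Y b|. *)
Lemma edge_sum s i j (F : 'I_N -> 'I_N -> R) (k : R) : i != j ->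
  F i j = k -> F j i = k ->
  (forall a b, (a, b) != (i, j) -> (a, b) != (j, i) -> F a b = 0) ->
  \sum_(a < N) F a (s a) = (edge s i j)%:R * k.
Proof.
move=> ij Fij Fji F0.
have FE a : F a (s a) = ((a == i) && (s i == j))%:R * k +
                        ((a == j) && (s j == i))%:R * k.
  have [->|ai] /= := eqVneq a i.
    rewrite (negbTE ij) mul0r addr0; have [->|sj] := eqVneq (s i) j.
      by rewrite Fij mul1r.
    by rewrite mul0r F0// xpair_eqE ?eqxx// (negbTE ij).
  have [->|aj] /= := eqVneq a j.
    rewrite mul0r add0r; have [->|sj] := eqVneq (s j) i.
      by rewrite Fji mul1r.
    by rewrite mul0r F0// xpair_eqE ?eqxx ?(negbTE sj)// eq_sym (negbTE ij).
  by rewrite !mul0r addr0 F0// xpair_eqE ?(negbTE ai) ?(negbTE aj).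
under eq_bigr do rewrite FE.
rewrite big_split /= /edge natrD mulrDl; congr (_ + _).
  rewrite (bigD1 i)//= eqxx /= big1 ?addr0// => a /negbTE ->.
  by rewrite mul0r.
rewrite (bigD1 j)//= eqxx /= big1 ?addr0// => a /negbTE ->.
by rewrite mul0r.
Qed.

Lemma ltr_sqrt_addr (A B : R) : 0 <= A -> 0 < B ->
  Num.sqrt A < Num.sqrt (A + B).
Proof. by move=> A0 B0; rewrite ltr_sqrt ?ltrDl// ltr_wpDl. Qed.

(** A vector orthogonal to w lengthens both w + u and w - u, by Pythagoras. Here [v] is the first
    basis vector if w 0 0 = 0 and (- w 0 1, w 0 0, 0) otherwise, rescaled to length e. *)
Lemma ex_perturbation_longer (w : 'rV[R]_3) (e : R) : 0 < e -> exists u : 'rV[R]_3,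
  [/\ l2norm u <= e, l2norm w < l2norm (w + u) & l2norm w < l2norm (w - u)].
Proof.
move=> e0.
pose v : 'rV[R]_3 := if (w 0 0 == 0) then \row_i (i == 0)%:R
  else \row_i (if i == 0 then - w 0 1 else if i == 1 then w 0 0 else 0).
have sq x : \sum_(i < 3) x i = x 0 + x 1 + x (2%:R) :> R.
  by rewrite !big_ord_recl big_ord0 addr0 addrA; congr (x _ + x _ + x _); apply/val_inj.
have vv : 0 < \sum_(i < 3) v 0 i ^+ 2.
  rewrite sq /v; have [w0|w0] := eqVneq (w 0 0) 0; rewrite !mxE /=.
    by rewrite !expr0n expr1n /= !addr0.
  rewrite expr0n /= addr0 sqrrN ltr_wpDl ?sqr_ge0//.
  by rewrite lt_neqAle sqr_ge0 andbT eq_sym expf_eq0.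
have vw : \sum_(i < 3) w 0 i * v 0 i = 0.
  rewrite sq /v; have [w0|w0] := eqVneq (w 0 0) 0; rewrite !mxE /=.
    by rewrite w0 !mulr0 mul0r !addr0.
  by ring.
set n := \sum_(i < 3) v 0 i ^+ 2 in vv.
pose c := e / Num.sqrt n.
have n0 : 0 < Num.sqrt n by rewrite sqrtr_gt0.
have c0 : 0 < c by rewrite divr_gt0.
have E (d : R) : l2norm (w + d *: v) =
    Num.sqrt (\sum_(i < 3) w 0 i ^+ 2 + d ^+ 2 * n).
  congr Num.sqrt.
  transitivity (\sum_(i < 3) w 0 i ^+ 2 + (2 * d) * (\sum_(i < 3) w 0 i * v 0 i)
    + d ^+ 2 * n).
    rewrite /n !mulr_sumr -!big_split /=; apply: eq_bigr => i _.
    by rewrite !mxE; ring.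
  by rewrite vw mulr0 addr0.
exists (c *: v); split.
- rewrite -[c *: v]add0r; have -> : l2norm (0 + c *: v) = c * Num.sqrt n.
    rewrite add0r -[in RHS](ger0_norm (ltW c0)) -sqrtr_sqr -sqrtrM ?sqr_ge0//.
    congr Num.sqrt; rewrite /n mulr_sumr; apply: eq_bigr => i _.
    by rewrite mxE exprMn.
  by rewrite /c divfK ?gt_eqF.
- rewrite E; apply: ltr_sqrt_addr; first by apply: sumr_ge0 => i _; exact: sqr_ge0.
  by rewrite mulr_gt0// exprn_gt0.
- rewrite -scaleNr E; apply: ltr_sqrt_addr.
    by apply: sumr_ge0 => i _; exact: sqr_ge0.
  by rewrite sqrrN mulr_gt0// exprn_gt0.
Qed.

Lemma l2norm_eq0 (n : nat) (x : 'rV[R]_n) : l2norm x = 0 -> x = 0.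
Proof.
move=> x0; apply/rowP => i; rewrite mxE.
exact: (@sqrt_sum_sqr_eq0 R n (fun k => x 0 k) i x0).
Qed.

Lemma config_separation Y : exists2 m : R, 0 < m &
  forall i j, i != j -> m <= l2norm (Y i - Y j).
Proof.
exists (\big[Num.min/1]_(p : 'I_N * 'I_N | p.1 != p.2) l2norm (Y p.1 - Y p.2)).
  apply: lt_bigmin => // -[i j] /= ij.
  rewrite lt_neqAle l2norm_ge0 andbT eq_sym; apply: contra_neq ij.
  by move=> /l2norm_eq0/eqP; rewrite subr_eq0 => /eqP/center_inj.
move=> i j ij.
exact: (@bigmin_le_cond _ _ _ 1 (i, j) (fun p => p.1 != p.2)
  (fun p : 'I_N * 'I_N => l2norm (Y p.1 - Y p.2))).
Qed.

(** The booleans select which of [Y i] and [Y j] are translated by [u]; the four choices are the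
    corners of a second difference. *)
Lemma config_perturb Y (i j : 'I_N) (e : R) : 0 < e ->
  exists2 d : R, 0 < d & forall u : 'rV[R]_3, l2norm u <= d ->
  forall p q : bool, exists Z : config R N,
    config_dist Y Z < e /\
    forall k, Z k = Y k + ((k == i) && p)%:R *: u + ((k == j) && q)%:R *: u.
Proof.
move=> e0; have [m m0 mY] := config_separation Y.
(* A centre moves by at most 2 d: distances change by at most 4 d < m, which keeps the centres
   distinct, and the configuration moves by at most 2 N d < e. *)
pose d := Num.min (m / 5) (e / (2 * N.+1%:R)).
have d0 : 0 < d by rewrite lt_min !divr_gt0.
exists d => // u ud p q.
pose z k := Y k + (((k == i) && p)%:R *: u + ((k == j) && q)%:R *: u).
have nb (b : bool) : l2norm (b%:R *: u) <= d.
  by case: b; rewrite ?scale1r// scale0r l2norm0 ltW.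
have nz k : l2norm (((k == i) && p)%:R *: u + ((k == j) && q)%:R *: u) <= 2 * d.
  by rewrite mulr_natl mulr2n (le_trans (l2normD _ _))// lerD.
have zi : injective z.
  move=> a b zab; apply/eqP; apply: contraT => ab.
  have := mY _ _ ab.
  have -> : Y a - Y b =
     (((b == i) && p)%:R *: u + ((b == j) && q)%:R *: u) -
     (((a == i) && p)%:R *: u + ((a == j) && q)%:R *: u).
    set Pb := (X in _ = X - _); set Pa := (X in _ = _ - X).
    have -> : Y a = z a - Pa by rewrite /z addrK.
    have -> : Y b = z b - Pb by rewrite /z addrK.
    by rewrite zab opprB addrC addrA subrK.
  move=> /le_trans/(_ (l2normD _ _)); rewrite l2normN.
  have := nz a; have := nz b; have : d <= m / 5 by rewrite ge_min lexx.
  by move: m0; lra.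
exists (Config zi); split; last by move=> k; rewrite -addrA.
have := @config_dist_le Y (Config zi) (2 * d).
rewrite mulr_ge0 ?(ltW d0)// => /(_ isT) H.
apply: (le_lt_trans (H _)).
  move=> k /=; rewrite /z opprD addrA subrr add0r l2normN; exact: nz.
have : d <= e / (2 * N.+1%:R) by rewrite ge_min lexx orbT.
rewrite ler_pdivlMr; last by rewrite mulr_gt0.
apply: lt_le_trans; rewrite mulrC [ltRHS]mulrA [d * 2]mulrC.
by rewrite ltr_pM2l ?mulr_gt0// ltr_nat.
Qed.

Lemma subr_add3 (V : zmodType) (a b x y x' y' : V) :
  a + x + y - (b + x' + y') = a - b + (x - x' + (y - y')).
Proof. by rewrite !opprD addrACA [a + x + _]addrACA -[LHS]addrA. Qed.

(* Moving [Y i] and [Y j] by the same vector, in the second mixed difference of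
   [perm_size s] only the terms |Y i - Y j| survive, with coefficient
   [edge s i j]. *)
Lemma dense_perm_size_neq s t : edges_differ s t ->
  dense [set Y : config R N | perm_size s Y != perm_size t Y].
Proof.
move=> /existsP[i /existsP[j /andP[ij est]]] O [Y OY] oO.
have /nbhs_configP[e e0 eO] : nbhs Y O by exact: open_nbhs_nbhs.
have [d d0 dP] := config_perturb Y i j e0.
have [u [ud wu wNu]] := ex_perturbation_longer (Y i - Y j) d0.
have H (p q : bool) := dP u ud p q.
have [Z00 [D00 Z00E]] := H false false.
have [Z10 [D10 Z10E]] := H true false.
have [Z01 [D01 Z01E]] := H false true.
have [Z11 [D11 Z11E]] := H true true.
apply: contrapT => nO.
have hO Z : config_dist Y Z < e -> perm_size s Z = perm_size t Z.
  move=> YZ; apply/eqP/negP => /negP st; apply: nO.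
  by exists Z; split => //; exact: eO.
pose F a b := l2norm (Z11 a - Z11 b) - l2norm (Z10 a - Z10 b)
  - l2norm (Z01 a - Z01 b) + l2norm (Z00 a - Z00 b).
(* The mixed difference of |Y i - Y j|: moving both centres or none preserves the difference vector
   w, moving one gives w + u or w - u. It is negative by the choice of [u]. *)
pose k := 2 * l2norm (Y i - Y j) - l2norm (Y i - Y j + u)
  - l2norm (Y i - Y j - u).
pose L a b (x : R) := l2norm (Y a - Y b + x *: u).
(* [al] and [be] are the coefficients of [u] by which Y a - Y b changes when Y i, respectively Y j,
   is moved. *)
pose al a b : R := (a == i)%:R - (b == i)%:R.
pose be a b : R := (a == j)%:R - (b == j)%:R.
have FE a b : F a b = L a b (al a b + be a b) - L a b (al a b) - L a b (be a b)
    + L a b 0.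
  rewrite /F /L !Z11E !Z10E !Z01E !Z00E !andbT !andbF !scale0r !addr0.
  congr (_ - _ - _ + _).
  - congr l2norm; rewrite /al /be !scalerDl !scaleNr; exact: subr_add3.
  - by congr l2norm; rewrite /al scalerDl scaleNr opprD addrACA.
  - by congr l2norm; rewrite /be scalerDl scaleNr opprD addrACA.
have SF (r : 'S_N) : \sum_(a < N) F a (r a) = (edge r i j)%:R * k.
  apply: edge_sum => //.
  - rewrite FE /al /be !eqxx (negbTE ij) [j == i]eq_sym (negbTE ij) /L /k.
    rewrite subr0 sub0r subrr scale0r scale1r scaleN1r addr0; ring.
  - rewrite FE /al /be !eqxx (negbTE ij) [j == i]eq_sym (negbTE ij) /L /k.
    rewrite subr0 sub0r addNr scale0r scale1r scaleN1r addr0.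
    have -> : Y j - Y i = - (Y i - Y j) by rewrite opprB.
    have E1 (w : 'rV[R]_3) : l2norm (- w - u) = l2norm (w + u).
      by rewrite -opprD l2normN.
    have E2 (w : 'rV[R]_3) : l2norm (- w + u) = l2norm (w - u).
      by rewrite addrC -[u - w]opprB l2normN.
    by rewrite E1 E2 l2normN; ring.
  (* For any other pair, one of the two motions leaves Y a - Y b fixed and the mixed difference
     cancels. *)
  - move=> a b abij abji; rewrite FE.
    have [->|->] : al a b = 0 \/ be a b = 0; last first.
    + by rewrite addr0; ring.
    + by rewrite add0r; ring.
    rewrite /al /be; move: abij abji; rewrite !xpair_eqE.
    have [->|ai] := eqVneq a i.
      have [->|bi] := eqVneq b i; first by left; rewrite subrr.
      have [bj|bj] := eqVneq b j; first by rewrite ?eqxx.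
      by right; rewrite ?(negbTE ij) subrr.
    have [->|bi] := eqVneq b i; last by left; rewrite subrr.
    have [aj|aj] := eqVneq a j; first by rewrite ?eqxx.
    by right; rewrite ?(negbTE ij) subrr.
have SE (r : 'S_N) : \sum_(a < N) F a (r a) =
  perm_size r Z11 - perm_size r Z10 - perm_size r Z01 + perm_size r Z00.
  by rewrite /F /perm_size big_split /= !sumrB.
have := SF s; have := SF t; rewrite !SE !hO// => -> /eqP.
rewrite -subr_eq0 -mulrBl mulf_eq0; apply/negP; rewrite negb_or; apply/andP.
split; first by rewrite subr_eq0 eqr_nat eq_sym.
by rewrite /k; apply: contraTneq wu => k0; rewrite -leNgt; move: k0 wNu; lra.
Qed.

Lemma dense_open_bigcap (I : eqType) (r : seq I) (A : I -> set (config R N)) :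
  (forall c, c \in r -> open (A c) /\ dense (A c)) ->
  let B := [set Y | forall c, c \in r -> A c Y] in open B /\ dense B.
Proof.
elim: r => [|c r ih] H /=.
  have -> : [set Y | forall c, c \in [::] -> A c Y] = setT.
    by apply/seteqP; split.
  split; first exact: openT.
  by move=> O O0 _; rewrite setIT.
have [|oB dB] := ih; first by move=> d dr; apply: H; rewrite in_cons dr orbT.
have [oA dA] := H c (mem_head _ _).
have -> : [set Y | forall d, d \in c :: r -> A d Y] =
    A c `&` [set Y | forall d, d \in r -> A d Y].
  apply/seteqP; split => Y /= HY.
    by split; [apply: HY; rewrite mem_head|move=> d dr; apply: HY; rewrite in_cons dr orbT].
  by case: HY => Ac Ar d; rewrite in_cons => /predU1P[->//|/Ar].
by split; [exact: openI|exact: denseI].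
Qed.

Lemma open_dense_generic : open generic_config /\ dense generic_config.
Proof.
have := @dense_open_bigcap _
  [seq p <- enum {: 'S_N * 'S_N} | edges_differ p.1 p.2]
  (fun p => [set Y : config R N | perm_size p.1 Y != perm_size p.2 Y]).
have <- : generic_config = [set Y | forall p, p \in
    [seq p <- enum {: 'S_N * 'S_N} | edges_differ p.1 p.2] ->
    perm_size p.1 Y != perm_size p.2 Y].
  apply/seteqP; split => Y /= HY.
    by move=> p; rewrite mem_filter => /andP[/HY].
  by move=> s t st; apply: (HY (s, t)); rewrite mem_filter st mem_enum.
apply => p; rewrite mem_filter => /andP[pd _].
by split; [exact: open_perm_size_neq|exact: dense_perm_size_neq].
Qed.

End Configurations.

(** * Dominant terms *)

Section Dominance.
Context {R : realType}.
Local Notation C := R[i].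
Local Notation nrm := (@Normc.normc R).

(** The form in which the determinant arises: indexed by a finite type, with real frequencies, so
    that |exp(i b z)| = exp(- b Im z). *)
Definition expoly (I : finType) (P : I -> {poly C}) (b : I -> R) (z : C) : C :=
  \sum_s (P s).[z] * cexp ('i * (b s)%:C * z).

Lemma nrm_cexp_i (b : R) (z : C) : nrm (cexp ('i * b%:C * z)) = expR (- (b * Im z)).
Proof.
by rewrite nrm_cexp !ReMc !ImMc /=; congr expR; ring.
Qed.

Lemma poly_upper (p : {poly C}) : exists2 A : R, 0 <= A &
  forall z, 1 <= nrm z -> nrm p.[z] <= A * nrm z ^+ size p.
Proof.
exists (\sum_(i < size p) nrm p`_i); first by apply: sumr_ge0 => i _; exact: nrm_ge0.
move=> z z1; rewrite horner_coef (le_trans (nrm_sum _ _ _))// mulr_suml.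
apply: ler_sum => i _; rewrite nrmM nrmX ler_wpM2l ?nrm_ge0//.
by rewrite ler_weXn2l// ltnW.
Qed.

(** Beyond 1 plus the sum of the moduli of the roots, every factor z - x has modulus at least 1,
    which leaves the leading coefficient. *)
Lemma poly_lower (p : {poly C}) : p != 0 -> exists c K : R, [/\ 0 < c, 0 < K &
  forall z, K <= nrm z -> c <= nrm p.[z]].
Proof.
move=> p0; have [r pE] := closed_field_poly_normal p.
exists (nrm (lead_coef p)), (1 + \sum_(x <- r) nrm x); split.
- by rewrite nrm_gt0 lead_coef_eq0.
- by rewrite ltr_pwDl// sumr_ge0// => x _; exact: nrm_ge0.
move=> z zK; rewrite {2}pE hornerZ nrmM ler_peMr ?nrm_ge0//.
move: zK {pE}; elim: r => [|x r ih] zK.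
  by rewrite big_nil hornerE nrm1.
move: zK; rewrite !big_cons hornerM nrmM => zK.
rewrite -[leLHS]mulr1 ler_pM//; last first.
  by apply: ih; rewrite (le_trans _ zK)// lerD2l lerDr nrm_ge0.
rewrite !hornerE (le_trans _ (nrm_dist _ _))// lerBrDr (le_trans _ zK)// lerD2l lerDl.
by rewrite sumr_ge0// => y _; exact: nrm_ge0.
Qed.

Lemma expR_ge_expn (x : R) (n : nat) : 0 <= x -> (0 < n)%N ->
  (x / n%:R) ^+ n <= expR x.
Proof.
move=> x0 n0; have -> : expR x = expR (x / n%:R) ^+ n.
  by rewrite -expRM_natl mulrC divfK// pnatr_eq0 -lt0n.
rewrite lerXn2r ?nnegrE ?expR_ge0 ?divr_ge0//.
by rewrite (le_trans _ (expR_ge1Dx _))// lerDr.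
Qed.

(** Since exp(b y) >= (b y / n)^n and y^2 >= |z|, exp(b y) is at least a constant times |z|^m.
    Taking m one above the growth exponent [size p] leaves a factor |z| to beat the constants. *)
Lemma poly_exp_small (p : {poly C}) (b e : R) : 0 < b -> 0 < e ->
  exists2 K : R, 0 < K & forall z, K <= nrm z -> 0 <= Im z ->
    nrm z <= Im z ^+ 2 -> nrm (p.[z] * cexp ('i * b%:C * z)) < e.
Proof.
move=> b0 e0; have [A A0 pA] := poly_upper p.
pose m := (size p).+1; pose n := (2 * m)%N.
pose B := (n%:R / b) ^+ n : R.
have n0 : (0 < n)%N by rewrite muln_gt0.
have B0 : 0 < B by rewrite exprn_gt0// divr_gt0// ltr0n.
exists (1 + A * B / e).
  by rewrite ltr_pwDl// divr_ge0 ?(ltW e0)// mulr_ge0// ltW.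
move=> z zK y0 zy.
have z1 : 1 <= nrm z.
  by rewrite (le_trans _ zK)// lerDl divr_ge0 ?(ltW e0)// mulr_ge0// ltW.
have zp : 0 < nrm z by rewrite (lt_le_trans ltr01).
rewrite nrmM nrm_cexp_i expRN.
have E : nrm z ^+ m <= B * expR (b * Im z).
  have := expR_ge_expn (mulr_ge0 (ltW b0) y0) n0.
  rewrite -(ler_pM2l B0); apply: le_trans.
  rewrite /B -exprMn.
  have -> : n%:R / b * (b * Im z / n%:R) = Im z.
    rewrite mulrA (mulrA (n%:R / b)) divfK ?gt_eqF// mulrAC divff ?mul1r//.
    by rewrite pnatr_eq0 -lt0n.
  by rewrite /n exprM lerXn2r ?nnegrE ?nrm_ge0// sqr_ge0.
rewrite ltr_pdivrMr ?expR_gt0//.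
rewrite -(ltr_pM2l B0).
have AB : A * B < e * nrm z.
  by rewrite [ltRHS]mulrC -ltr_pdivrMr// (lt_le_trans _ zK)// ltrDr.
apply: (@le_lt_trans _ _ (A * B * nrm z ^+ size p)).
  by rewrite [A * B]mulrC -mulrA ler_wpM2l ?(ltW B0)// pA.
apply: (@lt_le_trans _ _ (e * nrm z * nrm z ^+ size p)).
  by rewrite ltr_pM2r// exprn_gt0.
by rewrite -mulrA -exprS mulrCA ler_wpM2l// ltW.
Qed.

(** The frequency 0 coefficient is at least some c > 0 far out, while each term of positive
    frequency is below c / (#|I| + 1), so that together they stay below c. *)
Lemma expoly_dominated (I : finType) (P : I -> {poly C}) (b : I -> R) :
  (forall s, 0 <= b s) -> \sum_(s | b s == 0) P s != 0 ->
  exists2 K : R, 0 < K & forall z, K <= nrm z -> 0 <= Im z ->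
    nrm z <= Im z ^+ 2 ->
    nrm (expoly P b z - (\sum_(s | b s == 0) P s).[z]) <
    nrm (\sum_(s | b s == 0) P s).[z].
Proof.
move=> b0 P0; have [c [K0 [c0 K00 cK]]] := poly_lower P0.
have H s : exists K : R, 0 < K /\ forall z, K <= nrm z -> 0 <= Im z ->
    nrm z <= Im z ^+ 2 -> b s != 0 ->
    nrm ((P s).[z] * cexp ('i * (b s)%:C * z)) < c / #|I|.+1%:R.
  have [bs|bs] := eqVneq (b s) 0; first by exists 1.
  have [||K KK HK] := @poly_exp_small (P s) (b s) (c / #|I|.+1%:R).
  - by rewrite lt_neqAle eq_sym bs b0.
  - by rewrite divr_gt0.
  - by exists K; split => // z zK y0 zy _; exact: HK.
have [K HK] := fin_all_exists H.
exists (K0 + \sum_s K s).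
  by rewrite ltr_pwDl// sumr_ge0// => s _; have [/ltW] := HK s.
move=> z zK y0 zy.
have Ks s : K s <= nrm z.
  rewrite (le_trans _ zK)// (bigD1 s)//= addrCA lerDl addr_ge0 ?(ltW K00)//.
  by rewrite sumr_ge0// => t _; have [/ltW] := HK t.
have -> : expoly P b z - (\sum_(s | b s == 0) P s).[z] =
    \sum_(s | b s != 0) (P s).[z] * cexp ('i * (b s)%:C * z).
  rewrite /expoly (bigID (fun s => b s == 0)) /= horner_sum addrAC.
  have -> : \sum_(s | b s == 0) (P s).[z] * cexp ('i * (b s)%:C * z) =
      \sum_(s | b s == 0) (P s).[z].
    by apply: eq_bigr => s /eqP ->; rewrite rmorph0 mulr0 mul0r cexp0 mulr1.
  by rewrite subrr add0r.
rewrite (le_lt_trans (nrm_sum _ _ _))//.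
apply: (@le_lt_trans _ _ (\sum_(s : I) c / #|I|.+1%:R)).
  rewrite [leRHS](bigID (fun s => b s != 0)) /=.
  rewrite -[leLHS]addr0 lerD//.
    by apply: ler_sum => s bs; have [_ /(_ z (Ks s) y0 zy bs) /ltW] := HK s.
  by apply: sumr_ge0 => s _; rewrite divr_ge0// ltW.
rewrite sumr_const -[ltLHS]mulr_natr mulrAC ltr_pdivrMr//.
apply: (@lt_le_trans _ _ (c * #|I|.+1%:R)).
  by rewrite ltr_pM2l// ltr_nat.
rewrite ler_pM2r//; apply: cK; rewrite (le_trans _ zK)// lerDl.
by rewrite sumr_ge0// => s _; have [/ltW] := HK s.
Qed.

End Dominance.

(** * Zeros on compact sets, arguments along sides *)

Section ZerosAndSides.
Context {R : realType}.
Local Notation C := R[i].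
Local Notation nrm := (@Normc.normc R).

Lemma continuous_near_eq (T U : topologicalType) (f g : T -> U) (x : T) :
  (\forall y \near x, f y = g y) -> {for x, continuous f} ->
  {for x, continuous g}.
Proof.
move=> fg; rewrite /prop_for /continuous_at -(nbhs_singleton fg).
by move=> cf; apply: cvg_trans cf; exact: near_eq_cvg.
Qed.

Lemma continuous_expsum l : continuous (expsum l : C -> C).
Proof. exact: continuous_is_derive (is_derive_expsum l). Qed.

Lemma continuous_cpoly (p : {poly C}) : continuous (horner p).
Proof. exact: continuous_is_derive (is_derive_horner p). Qed.

Lemma nbhs_neq (z k : C) : z != k -> \forall w \near z, w != k.
Proof.
rewrite -subr_eq0 -nrm_gt0 => zk; apply/nbhs_nrmP; exists (nrm (z - k)) => // w /=.
by apply: contraTneq => ->; rewrite nrmB ltxx.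
Qed.

Lemma prod_sub_horner (Z : seq C) (m : C -> nat) (z : C) :
  \prod_(k <- Z) (z - k) ^+ m k = (\prod_(k <- Z) ('X - k%:P) ^+ m k).[z].
Proof. by rewrite horner_prod; apply: eq_bigr => k _; rewrite !hornerE. Qed.

(** Induction on the zeros: the cofactor for the remaining ones is divided by (z - k)^(m k), and the
    local factorization at k supplies continuity and a nonzero value there. *)
Lemma expsum_factor_seq l (Z : seq C) (m : C -> nat) : uniq Z ->
  (forall k, k \in Z -> zero_order l k (m k)) ->
  exists g : C -> C, [/\ continuous g,
    forall z, expsum l z = \prod_(k <- Z) (z - k) ^+ m k * g z &
    forall k, k \in Z -> g k != 0].
Proof.
elim: Z => [_ _|k Z ih /= /andP[kZ uZ] ord].
  exists (expsum l); split => //; first exact: continuous_expsum.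
  by move=> z; rewrite big_nil mul1r.
have [|g' [cg' g'E g'0]] := ih uZ.
  by move=> j jZ; apply: ord; rewrite in_cons jZ orbT.
have [ordk ordk0] := ord k (mem_head _ _).
have [gk [cgk gkk gkE]] := expsum_factor ordk.
have gk0 : gk k != 0.
  by rewrite gkk mulf_neq0// invr_eq0 pnatr_eq0 -lt0n fact_gt0.
pose p z : C := \prod_(j <- Z) (z - j) ^+ m j.
have pk : p k != 0.
  rewrite /p big_seq prodf_seq_neq0; apply/allP => j jZ; apply/implyP => _.
  rewrite expf_neq0// subr_eq0; apply: contraNneq kZ => ->; exact: jZ.
have cp : continuous p.
  have -> : p = horner (\prod_(j <- Z) ('X - j%:P) ^+ m j).
    by apply/funext => z; rewrite /p prod_sub_horner.
  exact: continuous_cpoly.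
(* Near k this agrees with gk / p, where [p], the product over the other zeros, does not vanish at
   k. *)
pose g z := if z == k then gk k / p k else g' z / (z - k) ^+ m k.
exists g; split.
- move=> z; have [->|zk] := eqVneq z k.
    apply: (@continuous_near_eq _ _ (fun w => gk w / p w)); last first.
      apply: continuousM; first exact: cgk.
      by apply: continuousV; [exact: pk|exact: cp].
    have /cvg_nrmP/(_ (nrm (p k))) : p w @[w --> k] --> p k by exact: cp.
    rewrite nrm_gt0 => /(_ pk); apply: filterS => w pw.
    have {}pw : p w != 0 by apply: contraTneq pw => ->; rewrite subr0 ltxx.
    rewrite /g; case: eqVneq => [-> //|wk].
    have wkm : (w - k) ^+ m k != 0 by rewrite expf_neq0// subr_eq0.
    have := gkE w; rewrite g'E -/(p w) => E.
    apply: (mulfI pw); apply: (mulfI wkm).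
    rewrite [p w * (gk w / p w)]mulrC divfK// -E.
    by rewrite [RHS]mulrCA [_ ^+ _ * (_ / _)]mulrC divfK.
  apply: (@continuous_near_eq _ _ (fun w => g' w / (w - k) ^+ m k)).
    by apply: filterS (nbhs_neq zk) => w; rewrite /g => /negbTE ->.
  apply: continuousM; first exact: cg'.
  apply: continuousV; first by rewrite expf_neq0// subr_eq0.
  have -> : (fun w : C => (w - k) ^+ m k) = horner (('X - k%:P) ^+ m k).
    by apply/funext => w; rewrite !hornerE.
  exact: continuous_cpoly.
- move=> z; rewrite big_cons -/(p z) /g; have [->|zk] := eqVneq z k.
    by rewrite gkE -mulrA [p k * _]mulrC divfK.
  rewrite g'E -/(p z) [_ ^+ _ * p z]mulrC -[RHS]mulrA; congr (_ * _).
  by rewrite [RHS]mulrC divfK// expf_neq0// subr_eq0.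
- move=> j; rewrite in_cons /g; have [->|jk] := eqVneq j k => /=.
    by rewrite mulf_neq0// invr_eq0.
  by move=> jZ; rewrite mulf_neq0 ?g'0// invr_eq0 expf_neq0// subr_eq0.
Qed.

Lemma expsum_isolated l (k z0 : C) : expsum l z0 != 0 ->
  \forall w \near k, w != k -> expsum l w != 0.
Proof.
move=> l0; have [m [lk mk]] := zero_order_ex k l0.
have [g [cg gk gE]] := expsum_factor lk.
have gk0 : g k != 0.
  by rewrite gk mulf_neq0// invr_eq0 pnatr_eq0 -lt0n fact_gt0.
have /cvg_nrmP/(_ (nrm (g k))) : g w @[w --> k] --> g k by exact: cg.
rewrite nrm_gt0 => /(_ gk0); apply: filterS => w gw wk.
rewrite gE mulf_neq0 ?expf_neq0 ?subr_eq0//.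
by apply: contraTneq gw => ->; rewrite subr0 ltxx.
Qed.

(** The set is covered by neighbourhoods in which only the centre can be a zero; the zeros are then
    among the centres of a finite subcover. *)
Lemma expsum_zeros_finite l (z0 : C) (K : set C) : expsum l z0 != 0 -> compact K ->
  exists Z : seq C, uniq Z /\ forall z, z \in Z <-> K z /\ expsum l z = 0.
Proof.
move=> l0; rewrite compact_cover => cK.
pose U (k : C) : set C := interior [set w | w != k -> expsum l w != 0].
have [|z Kz|D _ KD] := cK C [set: C] U.
- by move=> k _; exact: open_interior.
- by exists z => //; exact: expsum_isolated l0.
exists [seq z <- finmap.enum_fset D | `[<K z>] && (expsum l z == 0)].
split; first by rewrite filter_uniq// finmap.fset_uniq.
move=> z; rewrite mem_filter; split.
  by move=> /andP[/andP[/asboolP Kz /eqP z0'] _].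
move=> [Kz lz]; rewrite lz eqxx andbT; apply/andP; split; first exact/asboolP.
have [k /= kD /interior_subset /= zk] := KD z Kz.
have -> : z = k by apply/eqP; apply: contraT => /zk; rewrite lz eqxx.
exact: kD.
Qed.

(** * Variation of the argument along a side *)

Lemma is_argV (w : C) (t : R) : w != 0 -> is_arg w t -> is_arg w^-1 (- t).
Proof.
move=> w0 wt; have n0 : (nrm w)%:C != 0 by rewrite -normc_nrm normr_eq0.
have ct : cis t != 0 :> C by rewrite -nrm_gt0 nrm_cis.
rewrite /is_arg nrmV {1}wt invfM fmorphV; congr (_ * _).
by apply: (mulfI ct); rewrite divff// -cisD subrr cis0.
Qed.

Lemma is_arg_cis (t : R) : is_arg (cis t) t.
Proof. by rewrite /is_arg nrm_cis mul1r. Qed.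

Lemma is_arg_pos (r : R) : 0 < r -> is_arg r%:C 0.
Proof. by move=> r0; rewrite /is_arg nrmC gtr0_norm// cis0 mulr1. Qed.

(** The argument of w is V x plus those of q and h. Crossings of the imaginary axis bound the
    variation for q, and h, confined to the right half plane, adds at most one pi: hence [.+2] where
    the crossing bound has [.+1]. *)
Lemma side_variation (l : seq ({poly R} * R)) (V r : R) (w q h : R -> C)
    (th : R -> R) (a b : R) : a <= b -> 0 < r ->
  (forall x, a <= x <= b -> {for x, continuous th}) ->
  (forall x, a <= x <= b -> {for x, continuous h}) ->
  (forall x, a <= x <= b -> [/\ w x != 0, is_arg (w x) (th x),
     w x = r%:C * cis (V * x) * q x * h x, 0 < Re (h x) & Re (q x) = rexpsum l x]) ->
  `|th b - th a - V * (b - a)| <= pi * (\sum_(p <- l) size p.1).+2%:R.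
Proof.
move=> ab r0 cth ch H.
pose th' x := th x - V * x - arg (h x).
have A : `|th' b - th' a| <= pi * (\sum_(p <- l) size p.1).+1%:R.
  apply: (@rexpsum_arg_variation_le R l (fun x => nrm (q x)) th') => //.
  - move=> x xab; apply: continuousB; last first.
      apply: (@continuous_comp _ _ _ h arg); first exact: ch.
      by apply: continuous_arg; have [] := H x xab.
    apply: continuousB; first exact: cth.
    exact: mulrl_continuous.
  - move=> x xab; have [w0 _ wE _ _] := H x xab; rewrite nrm_gt0.
    by apply: contraNneq w0 => q0; rewrite wE q0 mulr0 mul0r.
  - move=> x xab; have [w0 wth wE h0 <-] := H x xab.
    suff qE : is_arg (q x) (th' x) by rewrite {1}qE ReMc /= mul0r subr0.
    have hx0 : h x != 0 by apply: contraTneq h0 => ->; rewrite ltxx.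
    have c0 : cis (V * x) != 0 :> C by rewrite -nrm_gt0 nrm_cis.
    have rC : r%:C != 0 by rewrite -(rmorph0 (real_complex R)) (inj_eq (@complexI R)) gt_eqF.
    have -> : th' x = (th x - (0 + V * x)) - arg (h x) by rewrite add0r.
    have -> : q x = w x * (r%:C * cis (V * x))^-1 * (h x)^-1.
      by rewrite wE; field; rewrite hx0 c0 rC.
    apply: is_argM; last by apply: is_argV => //; exact: argE.
    apply: is_argM => //; apply: is_argV; first by rewrite mulf_neq0.
    by apply: is_argM; [exact: is_arg_pos|exact: is_arg_cis].
have -> : th b - th a - V * (b - a) = (th' b - th' a) + (arg (h b) - arg (h a)).
  by rewrite /th'; ring.
rewrite -natr1 mulrDr mulr1 (le_trans (ler_normD _ _))// lerD//.
have := arg_gt (h a); have := arg_lt (h a).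
have := arg_gt (h b); have := arg_lt (h b).
by rewrite ler_norml => *; apply/andP; split; lra.
Qed.

Definition line (c d : C) (t : R) : C := c + d * t%:C.

Lemma continuous_line (c d : C) : continuous (line c d).
Proof.
move=> t.
apply: (@continuousD _ C^o _ (cst c) (fun s : R => d * s%:C)).
  exact: cst_continuous.
apply: (@continuousM _ _ (cst d) (fun s : R => s%:C)).
  exact: cst_continuous.
exact: continuous_real_complex.
Qed.

(** The factor [u] is there for the constant phases that the exponentials have along a vertical
    line. *)
Lemma line_poly (P : {poly C}) (c d u : C) : exists q : {poly R},
  (size q <= size P)%N /\ forall t, q.[t] = Re (u * P.[line c d t]).
Proof.
pose Q := u *: (P \Po (d *: 'X + c%:P)).
have sQ : (size Q <= size P)%N.
  rewrite (leq_trans (size_scale_leq _ _))//.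
  have [->|P0] := eqVneq P 0; first by rewrite comp_poly0.
  rewrite (leq_trans (size_comp_poly_leq _ _))//.
  rewrite -[leqRHS](@prednK) ?lt0n ?size_poly_eq0// ltnS -[leqRHS]muln1 leq_mul//.
  have : (size (d *: 'X + c%:P)%R <= 2)%N.
    rewrite (leq_trans (size_polyD _ _))// geq_max (leq_trans (size_scale_leq _ _)) ?size_polyX//=.
    by rewrite (leq_trans (size_polyC_leq1 _)).
  by case: (size _).
exists (\poly_(i < size Q) Re Q`_i); split.
  by rewrite (leq_trans (size_poly _ _)).
move=> t.
have -> : u * P.[line c d t] = Q.[t%:C].
  by rewrite /Q /line !hornerE horner_comp !hornerE addrC.
rewrite horner_poly horner_coef.
elim/big_ind2 : _ => [//|x1 x2 y1 y2 -> ->|i _]; first by rewrite ReDc.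
by rewrite -rmorphXn /= ReMc /= mulr0 subr0.
Qed.

End ZerosAndSides.

(** * Zeros in a rectangle *)

Section RectangleCount.
Context {R : realType}.
Local Notation C := R[i].
Local Notation nrm := (@Normc.normc R).

Lemma Re_line (c d : C) (t : R) : Re (line c d t) = Re c + Re d * t.
Proof. by rewrite ReDc ReMc /= mulr0 subr0. Qed.

Lemma Im_line (c d : C) (t : R) : Im (line c d t) = Im c + Im d * t.
Proof. by rewrite ImDc ImMc /= mulr0 add0r. Qed.

Lemma cexp_line (b x y : R) :
  cexp ('i * b%:C * (x +i* y)) = (expR (- b * y))%:C * cis (b * x).
Proof.
apply/eqP; rewrite eq_complex /=.
have -> : (0 * b - 1 * 0) * x - (0 * 0 + 1 * b) * y = - b * y by ring.
have -> : (0 * b - 1 * 0) * y + (0 * 0 + 1 * b) * x = b * x by ring.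
by rewrite !mul0r subr0 addr0 !eqxx.
Qed.

Variables (I : finType) (P : I -> {poly C}) (b : I -> R).

Definition expsum_of : seq ({poly C} * C) :=
  [seq (P s, 'i * (b s)%:C) | s <- index_enum I].

Lemma expoly_expsum : expoly P b = expsum expsum_of.
Proof. by apply/funext => z; rewrite /expoly /expsum /expsum_of big_map. Qed.

Lemma continuous_expoly : continuous (expoly P b).
Proof. by rewrite expoly_expsum; exact: continuous_expsum. Qed.

Definition total_size : nat := (\sum_s size (P s))%N.

Lemma size_sum_le_total (p : pred I) : (size (\sum_(s | p s) P s)%R <= total_size)%N.
Proof.
rewrite (leq_trans (size_sum _ _ _))//; apply/bigmax_leqP => s _.
by rewrite /total_size (bigD1 s)//= leq_addr.
Qed.

(** On Re z = x each exponential is the constant phase cis(b_s x) times exp(- b_s y), so Re f is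
    itself a real exponential sum in y, with coefficients whose sizes are bounded independently of
    x. *)
Lemma vertical_side (x T : R) (th : C -> R) : 0 <= T ->
  (forall y, - T <= y <= T -> [/\ expoly P b (x +i* y) != 0,
     is_arg (expoly P b (x +i* y)) (th (x +i* y)) &
     {for x +i* y, continuous th}]) ->
  `|th (x +i* T) - th (x -i* T)| <= pi * total_size.+2%:R.
Proof.
move=> T0 H; pose ln (y : R) := line x%:C 'i y.
have lnE y : ln y = x +i* y.
  by apply/eqP; rewrite eq_complex Re_line Im_line /= mul0r mul1r addr0 add0r !eqxx.
have Hq s : exists q : {poly R}, (size q <= size (P s))%N /\
    forall t, q.[t] = Re (cis (b s * x) * (P s).[ln t]) by exact: line_poly.
have [q qP] := fin_all_exists Hq.
pose l := [seq (q s, - b s) | s <- index_enum I].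
have sl : (\sum_(p <- l) size p.1 <= total_size)%N.
  by rewrite big_map /=; apply: leq_sum => s _; have [] := qP s.
have -> : th (x +i* T) - th (x -i* T) =
    th (ln T) - th (ln (- T)) - 0 * (T - - T).
  by rewrite !lnE mul0r subr0.
rewrite (@le_trans _ _ (pi * (\sum_(p <- l) size p.1).+2%:R))//; last first.
  by rewrite ler_pM2l ?pi_gt0// ler_nat !ltnS.
apply: (@side_variation R l 0 1 (fun y => expoly P b (ln y))
  (fun y => expoly P b (ln y)) (cst 1) (fun y => th (ln y))) => //.
- by rewrite (@le_trans _ _ 0)// oppr_le0.
- move=> y /H[_ _]; rewrite -lnE => cth.
  by apply: (@continuous_comp _ _ _ ln th); [exact: continuous_line|exact: cth].
- by move=> y _; exact: cst_continuous.
- move=> y /H[f0 fth _]; rewrite lnE; split => //.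
  + by rewrite mul0r cis0 rmorph1 !mul1r mulr1.
  + rewrite /expoly /rexpsum big_map.
    elim/big_ind2 : _ => [//|x1 x2 y1 y2 <- <-|s _]; first by rewrite ReDc.
    change (Re ((P s).[x +i* y] * cexp ('i * (b s)%:C * (x +i* y))) =
      (q s).[y] * expR (- b s * y)).
    rewrite (qP s).2 lnE cexp_line.
    have -> : (P s).[x +i* y] * ((expR (- b s * y))%:C * cis (b s * x)) =
      (cis (b s * x) * (P s).[x +i* y]) * (expR (- b s * y))%:C by ring.
    by rewrite [in LHS](ReMc _ (expR _)%:C) /= mulr0 subr0.
Qed.

(** Here the exponentials oscillate, so f is compared with a dominant term: the quotient stays in
    the right half plane, the exponential contributes exactly V times the length, and Q restricts to
    a polynomial. The top side is the case V = 0. *)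
Lemma horizontal_side (Q : {poly C}) (V X y : R) (th : C -> R) : 0 <= X ->
  (size Q <= total_size)%N ->
  (forall x, - X <= x <= X -> [/\
     is_arg (expoly P b (x +i* y)) (th (x +i* y)),
     {for x +i* y, continuous th} &
     nrm (expoly P b (x +i* y) - Q.[x +i* y] * cexp ('i * V%:C * (x +i* y))) <
     nrm (Q.[x +i* y] * cexp ('i * V%:C * (x +i* y)))]) ->
  `|th (X +i* y) - th (- X +i* y) - V * (2 * X)| <= pi * total_size.+2%:R.
Proof.
move=> X0 sQ H; pose ln (x : R) := line (0 +i* y) 1 x.
have lnE x : ln x = x +i* y.
  by apply/eqP; rewrite eq_complex Re_line Im_line /= mul0r mul1r addr0 add0r !eqxx.
have [q [sq qP]] := line_poly Q (0 +i* y) 1 1.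
pose l := [:: (q, 0 : R)].
have sl : (\sum_(p <- l) size p.1 <= total_size)%N.
  by rewrite big_seq1 (leq_trans sq).
have -> : 2 * X = X - - X by ring.
rewrite (@le_trans _ _ (pi * (\sum_(p <- l) size p.1).+2%:R))//; last first.
  by rewrite ler_pM2l ?pi_gt0// ler_nat !ltnS.
pose D z := Q.[z] * cexp ('i * V%:C * z).
rewrite -!lnE.
have cD : continuous D.
  move=> z; apply: continuousM; first exact: continuous_cpoly.
  exact: (continuous_is_derive (is_derive_cexpM _)).
have D0 x : - X <= x <= X -> D (ln x) != 0.
  by move=> /H[_ _]; rewrite -lnE => /(le_lt_trans (nrm_ge0 _)); rewrite nrm_gt0.
have E0 : (expR (- V * y))%:C != 0 :> C.
  by rewrite -nrm_gt0 nrmC normr_gt0 gt_eqF// expR_gt0.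
apply: (@side_variation R l V (expR (- V * y)) (fun x => expoly P b (ln x))
  (fun x => Q.[ln x]) (fun x => expoly P b (ln x) / D (ln x))
  (fun x => th (ln x))) => //.
- by rewrite (@le_trans _ _ 0)// oppr_le0.
- exact: expR_gt0.
- move=> x /H[_]; rewrite -lnE => cth _.
  by apply: (@continuous_comp _ _ _ ln th); [exact: continuous_line|exact: cth].
- move=> x xX; apply: continuousM.
    apply: (@continuous_comp _ _ _ ln (expoly P b)); first exact: continuous_line.
    exact: continuous_expoly.
  apply: continuousV; first exact: D0.
  by apply: (@continuous_comp _ _ _ ln D); [exact: continuous_line|exact: cD].
- move=> x xX; have [fth _ dom] := H x xX; have Dx := D0 x xX; split.
  + rewrite lnE; apply: contraTneq dom => ->.
    by rewrite sub0r nrmN ltxx.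
  + by rewrite lnE.
  + have <- : D (ln x) = (expR (- V * y))%:C * cis (V * x) * Q.[ln x].
      by rewrite /D lnE cexp_line mulrC.
    by rewrite [RHS]mulrC divfK.
  + by apply: Re_div_gt0; rewrite lnE.
  + by rewrite /rexpsum big_seq1 /= mul0r expR0 mulr1 qP mul1r.
Qed.

Lemma compact_rect (X T : R) : compact [set z : C | `|Re z| <= X /\ `|Im z| <= T].
Proof.
have -> : [set z : C | `|Re z| <= X /\ `|Im z| <= T] =
  (fun p : R * R => p.1 +i* p.2) @` (`[- X, X] `*` `[- T, T])%classic.
  apply/seteqP; split => [[x y] /= [xX yT]|_ [[x y] /= [+ +] <-]] /=.
    by exists (x, y) => //=; rewrite !in_itv /= -!ler_norml.
  by rewrite !in_itv /= -!ler_norml.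
apply: continuous_compact.
  apply: continuous_subspaceT => p.
  by apply: cvg_complex; [exact: cvg_fst|exact: cvg_snd].
by apply: compact_setX; exact: segment_compact.
Qed.

Lemma cisN_quarter (c : R) (w : C) :
  Re (w * cis (- (c + pi / 2))) = Im (w * cis (- c)) /\
  Im (w * cis (- (c + pi / 2))) = - Re (w * cis (- c)).
Proof.
have -> : cis (- (c + pi / 2)) = cis (- c) * - 'i :> C.
  rewrite opprD cisD; congr (_ * _); apply/eqP.
  by rewrite eq_complex /= cosN sinN cos_pihalf sin_pihalf oppr0 !eqxx.
by rewrite mulrA; case: (w * cis (- c)) => x y; split => /=; ring.
Qed.

(* Along the boundary, the argument of each factor [z - k] increases by 2 pi in
   total, and the argument of the zero-free cofactor returns to its value. *)
Lemma rect_count (V X T : R) (Z : seq C) (m : C -> nat) : 0 < X -> 0 < T ->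
  uniq Z ->
  (forall k, k \in Z -> [/\ `|Re k| < X, `|Im k| < T & zero_order expsum_of k (m k)]) ->
  (forall z, `|Re z| <= X -> `|Im z| <= T -> expoly P b z = 0 -> z \in Z) ->
  (forall x, - X <= x <= X ->
     nrm (expoly P b (x +i* T) - (\sum_(s | b s == 0) P s).[x +i* T]) <
     nrm (\sum_(s | b s == 0) P s).[x +i* T]) ->
  (forall x, - X <= x <= X ->
     nrm (expoly P b (x -i* T) - (\sum_(s | b s == V) P s).[x -i* T] *
       cexp ('i * V%:C * (x -i* T))) <
     nrm ((\sum_(s | b s == V) P s).[x -i* T] * cexp ('i * V%:C * (x -i* T)))) ->
  `|2 * pi * (\sum_(k <- Z) m k)%:R - V * (2 * X)| <=
    4 * (pi * total_size.+2%:R).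
Proof.
move=> X0 T0 uZ ZP Zall top bot.
have [|g [cg gE gZ]] := expsum_factor_seq uZ (l := expsum_of) (m := m).
  by move=> k /ZP[].
pose Q := [set z : C | `|Re z| <= X /\ `|Im z| <= T].
have g0 z : Q z -> g z != 0.
  move=> [zX zT]; have [zZ|zZ] := boolP (z \in Z); first exact: gZ.
  apply: contraNneq zZ => gz; apply: Zall => //.
  by rewrite expoly_expsum gE gz mulr0.
have Qstar z (t : R) : Q z -> 0 <= t <= 1 -> Q (t%:C * z).
  move=> [zX zT] /andP[t0 t1]; split.
    rewrite ReMc /= mul0r subr0 normrM ger0_norm// (le_trans _ zX)//.
    by rewrite ler_piMl.
  rewrite ImMc /= mul0r addr0 normrM ger0_norm// (le_trans _ zT)//.
  by rewrite ler_piMl.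
have Q0 : Q 0 by split; rewrite /= normr0 ltW.
have [thg thgP] := star_lift (compact_rect (X := X) (T := T)) Qstar Q0 cg g0.
(* An argument of f along the side with outward normal cis c: there every z - k has positive
   component along the normal, which is [ok]. *)
pose th c z := thg z + \sum_(k <- Z) (m k)%:R * arg_from c (z - k).
pose ok c z := forall k, k \in Z -> 0 < Re ((z - k) * cis (- c)).
have thP c z : Q z -> ok c z ->
    is_arg (expoly P b z) (th c z) /\ {for z, continuous (th c)}.
  move=> Qz okz; have [cthg thgE] := thgP z Qz; split.
    rewrite expoly_expsum gE /th addrC; apply: is_argM => //.
    apply: is_arg_prod_in => k kZ.
    by apply: is_argX; apply: is_arg_from; exact: okz.
  apply: continuousD; first exact: cthg.
  apply: continuous_sum_for => k kZ.
  apply: continuousM; first exact: cst_continuous.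
  by apply: continuous_arg_from; exact: okz.
have corner c z : ok c z -> ok (c + pi / 2) z -> th (c + pi / 2) z = th c z.
  move=> o1 o2; rewrite /th !big_seq; congr (_ + _).
  by apply: eq_bigr => k kZ; rewrite arg_from_corner ?o1 ?o2.
pose c1 : R := 0 + pi / 2; pose c2 := c1 + pi / 2; pose c3 := c2 + pi / 2.
pose c4 := c3 + pi / 2.
have R0 (w : C) : Re (w * cis (- 0)) = Re w /\ Im (w * cis (- 0)) = Im w.
  by rewrite oppr0 cis0 mulr1.
have R1 (w : C) : Re (w * cis (- c1)) = Im w /\ Im (w * cis (- c1)) = - Re w.
  by have [-> ->] := cisN_quarter 0 w; have [-> ->] := R0 w.
have R2 (w : C) : Re (w * cis (- c2)) = - Re w /\ Im (w * cis (- c2)) = - Im w.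
  by have [-> ->] := cisN_quarter c1 w; have [-> ->] := R1 w.
have R3 (w : C) : Re (w * cis (- c3)) = - Im w /\ Im (w * cis (- c3)) = Re w.
  by have [-> ->] := cisN_quarter c2 w; have [-> ->] := R2 w; rewrite opprK.
have R4 (w : C) : Re (w * cis (- c4)) = Re w.
  by have [-> _] := cisN_quarter c3 w; have [_ ->] := R3 w.
have okr z : Re z = X -> ok 0 z.
  move=> zX k /ZP[kX _ _]; have [-> _] := R0 (z - k).
  by rewrite ReDc ReNc zX subr_gt0 (le_lt_trans (ler_norm _)).
have okt z : Im z = T -> ok c1 z.
  move=> zT k /ZP[_ kT _]; have [-> _] := R1 (z - k).
  by rewrite ImDc ImNc zT subr_gt0 (le_lt_trans (ler_norm _)).
have okl z : Re z = - X -> ok c2 z.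
  move=> zX k /ZP[kX _ _]; have [-> _] := R2 (z - k).
  rewrite ReDc ReNc zX -opprD opprK.
  by move: kX; rewrite ltr_norml => /andP[]; lra.
have okb z : Im z = - T -> ok c3 z.
  move=> zT k /ZP[_ kT _]; have [-> _] := R3 (z - k).
  rewrite ImDc ImNc zT -opprD opprK.
  by move: kT; rewrite ltr_norml => /andP[]; lra.
have okr4 z : Re z = X -> ok c4 z.
  move=> zX k kZ; rewrite R4; have [<- _] := R0 (z - k); exact: okr.
have turn z : th c4 z = th 0 z + 2 * pi * (\sum_(k <- Z) m k)%:R.
  rewrite /th -addrA; congr (_ + _); rewrite natr_sum mulr_sumr -big_split /=.
  apply: eq_bigr => k _; rewrite /arg_from.
  have -> : cis (- c4) = cis (- 0) :> C.
    have [r i] := (R4 1, (cisN_quarter c3 1).2).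
    apply/eqP; rewrite eq_complex; move: r i; rewrite !mul1r => -> ->.
    by have [] := R3 1; rewrite !mul1r => -> _; rewrite oppr0 cis0 /= oppr0 !eqxx.
  by rewrite /c4 /c3 /c2 /c1; field.
have nzv x y : `|x| = X -> - T <= y <= T -> expoly P b (x +i* y) != 0.
  move=> xX yT; apply/eqP => f0.
  have /ZP[] : x +i* y \in Z by apply: Zall => //=; rewrite ?xX// ler_norml.
  by rewrite /= xX ltxx.
have Xn : `|X| = X by rewrite gtr0_norm.
have Tn : `|T| = T by rewrite gtr0_norm.
have right : `|th 0 (X +i* T) - th 0 (X -i* T)| <= pi * total_size.+2%:R.
  apply: vertical_side; first exact: ltW.
  move=> y yT; have [||] := thP 0 (X +i* y); last by split => //; exact: nzv.
    by rewrite /Q /= Xn ler_norml.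
  exact: okr.
have left : `|th c2 (- X +i* T) - th c2 (- X -i* T)| <= pi * total_size.+2%:R.
  apply: vertical_side; first exact: ltW.
  move=> y yT; have [||] := thP c2 (- X +i* y).
  - by rewrite /Q /= normrN Xn ler_norml.
  - exact: okl.
  - by split => //; apply: nzv => //; rewrite normrN.
have up : `|th c1 (X +i* T) - th c1 (- X +i* T) - 0 * (2 * X)| <=
    pi * total_size.+2%:R.
  apply: (horizontal_side (ltW X0) (size_sum_le_total (fun s => b s == 0))).
  move=> x xX; have [||? ?] := thP c1 (x +i* T).
  - by rewrite /Q /= Tn ler_norml.
  - exact: okt.
  split => //; rewrite rmorph0 mulr0 mul0r cexp0 mulr1; exact: top.
have down : `|th c3 (X -i* T) - th c3 (- X -i* T) - V * (2 * X)| <=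
    pi * total_size.+2%:R.
  apply: (horizontal_side (ltW X0) (size_sum_le_total (fun s => b s == V))).
  move=> x xX; have [||? ?] := thP c3 (x -i* T).
  - by rewrite /Q /= normrN Tn ler_norml.
  - exact: okb.
  by split => //; exact: bot.
have k1 : th c1 (X +i* T) = th 0 (X +i* T).
  by apply: corner; [exact: okr|exact: okt].
have k2 : th c2 (- X +i* T) = th c1 (- X +i* T).
  by apply: corner; [exact: okt|exact: okl].
have k3 : th c3 (- X -i* T) = th c2 (- X -i* T).
  by apply: corner; [exact: okl|exact: okb].
have k4 : th c4 (X -i* T) = th c3 (X -i* T).
  by apply: corner; [exact: okb|exact: okr4].
rewrite turn in k4; rewrite k1 mul0r subr0 in up; rewrite k2 in left.
rewrite k3 -k4 in down.
(* Adding the sides counterclockwise leaves the full turn from [turn]; each side costs one error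
   term, and only the bottom one contributes V * (2 * X). *)
move: right left up down; move: (2 * pi * _).
move: (th 0 (X +i* T)) (th 0 (X -i* T)) (th c1 (- X +i* T)) (th c2 (- X -i* T)).
move: (V * (2 * X)) (pi * _) => v u t1 t2 t3 t4 w.
rewrite !ler_norml => /andP[? ?] /andP[? ?] /andP[? ?] /andP[? ?].
by apply/andP; split; lra.
Qed.

End RectangleCount.

(** * Zeros in a disc *)

Section DiscCount.
Context {R : realType}.
Local Notation C := R[i].
Local Notation nrm := (@Normc.normc R).

Definition zero_count (h : C -> C) (r : R) : \bar R :=
  \esum_(k in [set k : C | `|k| < r%:C]) zero_mult h k.

Lemma leq_sum_uniq_sub (T : eqType) (s s' : seq T) (m : T -> nat) :
  uniq s -> uniq s' -> {subset s <= s'} ->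
  (\sum_(k <- s) m k <= \sum_(k <- s') m k)%N.
Proof.
move=> us us' ss'.
have ps : perm_eq [seq k <- s' | k \in s] s.
  apply: uniq_perm; rewrite ?filter_uniq// => x.
  by rewrite mem_filter; case xs: (x \in s) => //=; exact: ss'.
by rewrite -(perm_big _ ps) big_filter [leqRHS](bigID (mem s)) /= leq_addr.
Qed.

(** For placing vertical sides off the finitely many zeros. *)
Lemma avoid_seq (s : seq R) (a b : R) : a < b ->
  exists x, [/\ a < x, x < b & x \notin s].
Proof.
elim: s a b => [|c s ih] a b ab.
  by exists ((a + b) / 2); split => //; lra.
have [ac|ca] := ltP a c.
  have [|x [ax xb xs]] := ih a (Num.min b c); first by rewrite lt_min ab.
  move: xb; rewrite lt_min => /andP[xb xc]; exists x; split => //.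
  by rewrite in_cons negb_or xs andbT lt_eqF.
have [x [ax xb xs]] := ih a b ab; exists x; split => //.
by rewrite in_cons negb_or xs andbT gt_eqF// (le_lt_trans ca).
Qed.

Lemma esum_finite_support (D : set C) (Z : seq C) (m : C -> nat)
    (F : C -> \bar R) : uniq Z -> (forall k, k \in Z -> D k) ->
  (forall k, F k = (m k)%:R%:E) -> (forall k, D k -> k \notin Z -> m k = 0%N) ->
  \esum_(k in D) F k = (\sum_(k <- Z) m k)%:R%:E.
Proof.
move=> uZ ZD FE m0.
have F0 k : (0 <= F k)%E by rewrite FE lee_fin.
rewrite (esumID [set` Z])// [X in (_ + X)%E]esum1 ?adde0; last first.
  by move=> k [Dk /negP kZ]; rewrite FE m0.
have -> : D `&` [set` Z] = [set` Z].
  by apply/seteqP; split => k /= => [[]//|kZ]; split => //; exact: ZD.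
rewrite esum_fset//; last exact: finite_seq.
rewrite -fsbig_seq// natr_sum -sumEFin.
by apply: eq_bigr => k _; exact: FE.
Qed.

Variables (I : finType) (P : I -> {poly C}) (b : I -> R) (V : R).
Hypothesis b_ge0 : forall s, 0 <= b s.
Hypothesis b_le : forall s, b s <= V.
Hypothesis bottom_neq0 : \sum_(s | b s == 0) P s != 0.
Hypothesis top_neq0 : \sum_(s | b s == V) P s != 0.

Let f := expoly P b.

(* The substitution [z -> - z] exchanges the two dominant terms. *)
Lemma expoly_dominated_top : exists2 K : R, 0 < K & forall z, K <= nrm z ->
  Im z <= 0 -> nrm z <= Im z ^+ 2 ->
  nrm (f z - (\sum_(s | b s == V) P s).[z] * cexp ('i * V%:C * z)) <
  nrm ((\sum_(s | b s == V) P s).[z] * cexp ('i * V%:C * z)).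
Proof.
pose P' s := P s \Po (- 'X); pose b' s := V - b s.
have PE (p : {poly C}) z : (p \Po (- 'X)).[- z] = p.[z].
  by rewrite horner_comp !hornerE opprK.
have sumE : \sum_(s | b' s == 0) P' s = (\sum_(s | b s == V) P s) \Po (- 'X).
  rewrite [RHS](big_morph (fun p => p \Po (- 'X)) (fun p q => comp_polyD p q _)
    (comp_poly0 _)).
  by apply: eq_bigl => s; rewrite /b' subr_eq0 eq_sym.
have [||K K0 HK] := @expoly_dominated R I P' b'.
- by move=> s; rewrite subr_ge0.
- rewrite sumE; apply: contraNneq top_neq0 => /(congr1 (fun p => p \Po (- 'X))).
  by rewrite comp_poly0 -comp_polyA raddfN /= comp_polyX opprK comp_polyXr => ->.
exists K => // z zK y0 zy; have := HK (- z).
rewrite nrmN ImNc sqrrN oppr_ge0 => /(_ zK y0 zy).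
rewrite sumE PE.
have -> : expoly P' b' (- z) = f z * cexp (- ('i * V%:C * z)).
  rewrite /f /expoly mulr_suml; apply: eq_bigr => s _.
  rewrite PE -[RHS]mulrA -cexpD; congr (_ * cexp _).
  by rewrite /b' rmorphB /=; ring.
have e0 := cexp_neq0 ('i * V%:C * z).
rewrite -(ltr_pM2r (x := nrm (cexp ('i * V%:C * z)))) ?nrm_gt0// -!nrmM.
by rewrite mulrBl cexpN divfK.
Qed.

Lemma expoly_tail_neq0 : exists2 K : R, 0 < K & forall z, K <= nrm z ->
  nrm z <= Im z ^+ 2 ->
  [/\ 0 <= Im z -> nrm (f z - (\sum_(s | b s == 0) P s).[z]) <
       nrm (\sum_(s | b s == 0) P s).[z],
   Im z <= 0 ->
    nrm (f z - (\sum_(s | b s == V) P s).[z] * cexp ('i * V%:C * z)) <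
    nrm ((\sum_(s | b s == V) P s).[z] * cexp ('i * V%:C * z)) & f z != 0].
Proof.
have [K1 K10 H1] := expoly_dominated b_ge0 bottom_neq0.
have [K2 K20 H2] := expoly_dominated_top.
exists (K1 + K2); first by rewrite addr_gt0.
move=> z zK zy.
have z1 : K1 <= nrm z by rewrite (le_trans _ zK)// lerDl ltW.
have z2 : K2 <= nrm z by rewrite (le_trans _ zK)// lerDr ltW.
split; [by move=> y0; exact: H1|by move=> y0; exact: H2|].
have [y0|/ltW y0] := leP 0 (Im z).
  have := H1 z z1 y0 zy; apply: contraTneq => f0.
  by rewrite -/f f0 sub0r nrmN ltxx.
have := H2 z z2 y0 zy; apply: contraTneq => f0.
by rewrite f0 sub0r nrmN ltxx.
Qed.

Lemma expoly_disc_count : exists A : R, \forall r \near +oo,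
  (`| zero_count f r - (V / pi * r)%:E | <= A%:E)%E.
Proof.
have [K K0 HK] := expoly_tail_neq0.
(* For |Re z| <= X and y = |Im z| >= T X one has y >= 2 and y >= X, so |z| <= X + y <= y^2, and also
   |z| >= K: both dominance estimates apply on and beyond the horizontal sides. *)
pose T (X : R) := X + K + 2.
have far (X : R) z : 0 <= X -> `|Re z| <= X -> T X <= `|Im z| ->
    K <= nrm z /\ nrm z <= Im z ^+ 2.
  move=> X0 zX zT; split.
    rewrite (le_trans _ (Im_le_nrm _))// (le_trans _ zT)// /T.
    by move: X0; lra.
  rewrite (le_trans (nrm_le_ReIm _))// -[leRHS]real_normK ?num_real//.
  have T0 : 0 <= K + X + 2 by move: X0 K0; lra.
  move: zT zX X0 K0; rewrite /T; move: `|Re z| `|Im z| => u v.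
  nra.
have fE : f = expsum (expsum_of P b) by exact: expoly_expsum.
have [z0 fz0] : exists z0, expsum (expsum_of P b) z0 != 0.
  exists (0 +i* T 0); rewrite -fE.
  have [||k1 k2] := far 0 (0 +i* T 0) (lexx _); rewrite /= ?normr0//.
    by rewrite ler_norm.
  by have [] := HK _ k1 k2.
have [m mP] : exists m : C -> nat, forall k, zero_order (expsum_of P b) k (m k).
  have /choice[m mP] : forall k, exists n, zero_order (expsum_of P b) k n.
    by move=> k; exact: zero_order_ex fz0.
  by exists m.
have multE k : zero_mult f k = (m k)%:R%:E.
  by rewrite fE; exact: zero_mult_expsum.
have m0 k : f k != 0 -> m k = 0%N.
  move=> fk; apply/eqP; rewrite -leqn0 leqNgt; apply/negP => mk.
  by have [/(_ _ mk)/= /eqP + _] := mP k; rewrite -fE (negbTE fk).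
(* In the strip |Re z| <= X all zeros have |Im z| < T X, so a compact rectangle contains them. *)
have zerosX X : 0 <= X -> exists Z : seq C, uniq Z /\
    forall k, k \in Z <-> `|Re k| <= X /\ f k = 0.
  move=> X0.
  have [Z [uZ ZP]] := expsum_zeros_finite fz0 (compact_rect (X := X) (T := T X)).
  exists Z; split => // k; rewrite ZP /= -fE; split; first by move=> [[]].
  move=> [kX fk]; split => //; split => //; rewrite leNgt; apply/negP => /ltW kT.
  by have [k1 k2] := far X k X0 kX kT; have [_ _] := HK k k1 k2; rewrite fk eqxx.
(* The error of [rect_count] divided by 2 pi. *)
pose B : R := 2 * (total_size P).+2%:R.
have p0 := pi_gt0 R.
have count (X : R) Z : 0 < X -> uniq Z ->
    (forall k, k \in Z <-> `|Re k| <= X /\ f k = 0) ->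
    (forall k, k \in Z -> `|Re k| != X) ->
    `|(\sum_(k <- Z) m k)%:R - V / pi * X| <= B.
  move=> X0 uZ ZP ZX.
  have TX : 0 < T X by rewrite /T; move: X0 K0; lra.
  have TXn : `|T X| = T X by rewrite gtr0_norm.
  have H : `|2 * pi * (\sum_(k <- Z) m k)%:R - V * (2 * X)| <=
      4 * (pi * (total_size P).+2%:R).
    apply: (@rect_count R I P b V X (T X) Z m X0 TX uZ).
    - move=> k kZ; have [kX fk] := (ZP k).1 kZ; split; last exact: mP.
        by rewrite lt_neqAle kX andbT; exact: ZX.
      rewrite ltNge; apply/negP => kT.
      have [k1 k2] := far X k (ltW X0) kX kT.
      by have [_ _] := HK k k1 k2; rewrite fk eqxx.
    - by move=> z zX _ fz; apply/ZP.
    - move=> x xX; have [||k1 k2] := far X (x +i* T X) (ltW X0) => /=.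
      + by rewrite ler_norml.
      + by rewrite TXn.
      by have [H _ _] := HK _ k1 k2; apply: H; rewrite /= ltW.
    - move=> x xX; have [||k1 k2] := far X (x -i* T X) (ltW X0) => /=.
      + by rewrite ler_norml.
      + by rewrite normrN TXn.
      by have [_ H _] := HK _ k1 k2; apply: H; rewrite /= oppr_le0 ltW.
  move: H; set n := (\sum_(k <- Z) m k)%N.
  have -> : 2 * pi * n%:R - V * (2 * X) = (2 * pi) * (n%:R - V / pi * X).
    have E (c u v x : R) : 0 < c -> 2 * c * u - v * (2 * x) = (2 * c) * (u - v / c * x).
      by move=> c0; field; rewrite gt_eqF.
    exact: E.
  have p2 : 0 < 2 * pi :> R by rewrite mulr_gt0.
  rewrite normrM (gtr0_norm p2).
  have -> : 4 * (pi * (total_size P).+2%:R) = 2 * pi * B by rewrite /B; ring.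
  by rewrite ler_pM2l.
have V0 : 0 <= V.
  have [s _] : exists s : I, True.
    apply: contrapT => noI; move/eqP: bottom_neq0; apply; apply: big1 => s _.
    by exfalso; apply: noI; exists s.
  exact: le_trans (b_ge0 s) (b_le s).
(* The abscissas X1 and X2 chosen below differ from r by less than 2 and 1; this costs at most 2 V /
   pi. *)
exists (B + V / pi * 2).
exists (K + 3); split; first by rewrite num_real.
move=> r rK.
have r3 : 3 < r by move: rK K0; lra.
have [Z [uZ ZP]] := zerosX (r + 1) (addr_ge0 (ltW (lt_trans (ltr0Sn R 2) r3)) ler01).
pose bad := [seq `|Re k| | k <- Z].
(* Zeros with |Re k| <= X1 lie in the disc of radius r, and zeros in the disc satisfy |Re k| <= X2,
   so the disc count lies between two rectangle counts. *)
have [X1 [X1l X1r X1b]] : exists x, [/\ r - 2 < x, x < r - 1 & x \notin bad].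
  by apply: avoid_seq; lra.
have [X2 [X2l X2r X2b]] : exists x, [/\ r < x, x < r + 1 & x \notin bad].
  by apply: avoid_seq; lra.
have notbad X k : X \notin bad -> f k = 0 -> `|Re k| <= r + 1 -> `|Re k| != X.
  move=> Xb fk kr; apply: contraNneq Xb => <-; apply: map_f; exact/ZP.
have X10 : 0 < X1 by lra.
have X20 : 0 < X2 by lra.
have [Z1 [uZ1 Z1P]] := zerosX X1 (ltW X10).
have [Z2 [uZ2 Z2P]] := zerosX X2 (ltW X20).
have C1 : `|(\sum_(k <- Z1) m k)%:R - V / pi * X1| <= B.
  apply: count => // k /Z1P[kX fk]; apply: notbad => //.
  by rewrite (le_trans kX)//; lra.
have C2 : `|(\sum_(k <- Z2) m k)%:R - V / pi * X2| <= B.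
  apply: count => // k /Z2P[kX fk]; apply: notbad => //.
  by rewrite (le_trans kX)//; lra.
pose D := [seq k <- Z2 | nrm k < r].
have uD : uniq D by rewrite filter_uniq.
rewrite /zero_count (@esum_finite_support _ D m)//; last 2 first.
- by move=> k; rewrite mem_filter /= normc_nrm ltcR => /andP[].
- move=> k /=; rewrite normc_nrm ltcR => kr; rewrite mem_filter kr /= => kZ.
  apply: m0; apply: contraNneq kZ => fk; apply/Z2P; split => //.
  by rewrite (le_trans (Re_le_nrm _))// (le_trans (ltW kr))// ltW.
have D2 : (\sum_(k <- D) m k <= \sum_(k <- Z2) m k)%N.
  by apply: leq_sum_uniq_sub => // k; rewrite mem_filter => /andP[].
have D1 : (\sum_(k <- Z1) m k <= \sum_(k <- D) m k)%N.
  apply: leq_sum_uniq_sub => // k /Z1P[kX fk].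
  rewrite mem_filter; apply/andP; split; last first.
    by apply/Z2P; split => //; rewrite (le_trans kX)//; lra.
  have [kK|kK] := ltP (nrm k) K; first by rewrite (lt_trans kK)//; lra.
  (* Beyond K zeros satisfy (Im k)^2 < |k|. If |k| >= r, then |k|^2 < (r - 1)^2 + |k|, contradicting
     |k|^2 - |k| >= r^2 - r > (r - 1)^2. *)
  have ky : Im k ^+ 2 < nrm k.
    rewrite ltNge; apply/negP => ky.
    by have [_ _] := HK k kK ky; rewrite fk eqxx.
  have kx : Re k ^+ 2 <= X1 ^+ 2.
    by rewrite -[leLHS]real_normK ?num_real// lerXn2r ?nnegrE// ltW.
  have := nrm_sqr k; rewrite ltNge => nk; apply/negP => rk.
  have : X1 ^+ 2 < (r - 1) ^+ 2 by rewrite ltrXn2r ?nnegrE ?ltW//; lra.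
  move: nk ky kx rk r3; move: (nrm k) (Re k ^+ 2) (Im k ^+ 2) (X1 ^+ 2).
  by move=> u v w y; nra.
rewrite -EFinB abse_EFin lee_fin.
move: D1 D2; rewrite -(ler_nat R) -[(_ <= \sum_(k <- Z2) _)%N](ler_nat R).
have VX1 : V / pi * (r - 2) <= V / pi * X1.
  by rewrite ler_wpM2l ?(ltW X1l)// divr_ge0// ltW.
have VX2 : V / pi * X2 <= V / pi * (r + 1).
  by rewrite ler_wpM2l ?(ltW X2r)// divr_ge0// ltW.
have Vp : 0 <= V / pi by rewrite divr_ge0// ltW.
move: C1 C2 VX1 VX2 Vp; rewrite !ler_norml => /andP[? ?] /andP[? ?] *.
by apply/andP; split; lra.
Qed.

End DiscCount.

(** * The determinant of Gamma *)

Section ResonancePolynomial.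
Context {R : realType} {N : nat}.
Local Notation C := R[i].
Implicit Types (Y : config R N) (s t : 'S_N) (i j : 'I_N).

(** * Edges determine the fixed points and the sign *)

Lemma edge_gt0 s i : (0 < edge s i (s i))%N.
Proof. by rewrite /edge eqxx. Qed.

(** If s moved i, then t would use the edge {i, s i}; as t fixes i, it would send s i to i as well,
    against injectivity. *)
Lemma edge_fix s t i : (forall j, i != j -> edge s i j = edge t i j) ->
  t i = i -> s i = i.
Proof.
move=> st ti; apply/eqP; apply: contraT; rewrite eq_sym => isi.
have := edge_gt0 s i; rewrite st// /edge ti (negbTE isi) add0n lt0b => /eqP tsi.
by move/eqP: isi; case; apply: (@perm_inj _ t); rewrite ti tsi.
Qed.

Lemma sub_porbit s t (x : 'I_N) : (forall y, s y \in porbit t y) ->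
  porbit s x \subset porbit t x.
Proof.
move=> st; apply/fintype.subsetP => _ /porbitP[n ->].
elim: n => [|n ih]; first by rewrite expg0 perm1 porbit_id.
by rewrite expgSr permM; move: ih; rewrite -eq_porbit_mem => /eqP <-; exact: st.
Qed.

Lemma edge_porbit s t : (forall i j, i != j -> edge s i j = edge t i j) ->
  forall y, s y \in porbit t y.
Proof.
move=> st y; have [->|ys] := eqVneq (s y) y; first exact: porbit_id.
have := edge_gt0 s y; rewrite st 1?eq_sym// /edge.
have [<- _|_] := eqVneq (t y) (s y); first by have := mem_porbit t 1 y; rewrite expg1.
rewrite add0n lt0b => /eqP {2}<-.
by rewrite porbit_sym; have := mem_porbit t 1 (s y); rewrite expg1.
Qed.

(** Each step of s follows an edge of t in one of its two orientations, so s and t have the same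
    orbits, possibly run through in opposite directions. The sign depends only on the number of
    orbits. *)
Lemma edge_odd s t : (forall i j, i != j -> edge s i j = edge t i j) ->
  odd_perm s = odd_perm t.
Proof.
move=> st; rewrite /odd_perm; congr (_ (+) odd #|pred_of_set _|).
apply: eq_imset => x; apply/eqP; rewrite finset.eqEsubset.
rewrite !sub_porbit//; apply: edge_porbit => // i j ij.
by rewrite st.
Qed.

(** * The determinant as an exponential sum and its extreme coefficients *)

Variables (a : 'I_N -> C) (Y : config R N).

(** The coefficient of a permutation is split into a positive weight and a part that, up to the
    sign, depends only on its fixed points; cancellation can then come only from the second part. *)
Definition fix_poly s j : {poly C} :=
  if s j == j then (a j)%:P - ('i / (4 * pi)%:C) *: 'X else (-1)%:P.

Definition coef_weight s j : R :=
  if s j == j then 1 else (4 * pi * l2norm (Y j - Y (s j)))^-1.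

Definition weight s : R := \prod_j coef_weight s j.

Definition res_poly s : {poly C} :=
  (weight s)%:C *: ((-1) ^+ s *: \prod_j fix_poly s j).

Lemma l2norm_gt0 i j : i != j -> 0 < l2norm (Y i - Y j).
Proof.
move=> ij; rewrite lt_neqAle l2norm_ge0 andbT eq_sym; apply: contra_neq ij.
by move=> /l2norm_eq0/eqP; rewrite subr_eq0 => /eqP/center_inj.
Qed.

Lemma weight_gt0 s : 0 < weight s.
Proof.
apply: prodr_gt0 => j _; rewrite /coef_weight; case: eqVneq => // sj.
by rewrite invr_gt0 !mulr_gt0 ?pi_gt0// l2norm_gt0// eq_sym.
Qed.

Lemma Gamma_entry s j (z : C) : Gamma a Y z j (s j) =
  (coef_weight s j)%:C * (fix_poly s j).[z] *
  cexp ('i * (l2norm (Y j - Y (s j)))%:C * z).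
Proof.
rewrite mxE /coef_weight /fix_poly /green_tilde [j == _]eq_sym.
have [->|sj] := eqVneq (s j) j.
  rewrite subrr eqxx l2norm0 rmorph0 mulr0 mul0r cexp0 mulr1 rmorph1 mul1r.
  by rewrite subr0 !hornerE mulrAC.
rewrite mulr0n sub0r hornerC subr_eq0 (inj_eq (@center_inj _ _ Y)) eq_sym.
rewrite (negbTE sj) /green fmorphV mulrN1 mulNr mulrC.
by rewrite [_ * z * _]mulrAC.
Qed.

Lemma det_Gamma (z : C) :
  \det (Gamma a Y z) = expoly res_poly (fun s => perm_size s Y) z.
Proof.
apply: eq_bigr => s _.
have -> : 'i * (perm_size s Y)%:C * z =
    \sum_j 'i * (l2norm (Y j - Y (s j)))%:C * z.
  by rewrite /perm_size rmorph_sum mulr_sumr mulr_suml.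
rewrite cexp_sum /res_poly !hornerZ horner_prod /weight rmorph_prod.
under eq_bigr do rewrite Gamma_entry.
by rewrite 2!big_split !mulrA [(-1) ^+ s * _]mulrC.
Qed.

Lemma perm_size_ge0 s : 0 <= perm_size s Y.
Proof. by apply: sumr_ge0 => j _; exact: l2norm_ge0. Qed.

Lemma fix_poly_neq0 s j : fix_poly s j != 0.
Proof.
rewrite /fix_poly; case: ifP => _; last by rewrite polyC_eq0 oppr_eq0 oner_eq0.
apply/eqP => /(congr1 (fun p : {poly C} => p`_1)).
rewrite coefB coefC coefZ coefX /= mulr1 sub0r coef0 => /eqP.
rewrite oppr_eq0 mulf_eq0 invr_eq0; apply/negP; rewrite negb_or.
rewrite -!nrm_gt0 nrmC normr_gt0 mulf_neq0 ?pnatr_eq0 ?gt_eqF ?pi_gt0//.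
by rewrite andbT /= expr0n expr1n add0r sqrtr1 ltr01.
Qed.

Lemma signed_prod_neq0 s : (-1) ^+ s *: \prod_j fix_poly s j != 0.
Proof.
rewrite scaler_eq0 negb_or signr_eq0 /=.
by apply/prodf_neq0 => j _; exact: fix_poly_neq0.
Qed.

Lemma bottom_res_poly : \sum_(s | perm_size s Y == 0) res_poly s != 0.
Proof.
rewrite (big_pred1 1%g) => [|s /=].
  rewrite scaler_eq0 negb_or signed_prod_neq0 andbT.
  by rewrite -nrm_gt0 nrmC normr_gt0 gt_eqF// weight_gt0.
apply/eqP/eqP => [/eqP|->].
  rewrite psumr_eq0 => [/allP s0|j _]; last exact: l2norm_ge0.
  apply/permP => j; rewrite perm1; apply/eqP; apply: contraT => sj.
  have /eqP := s0 j (mem_index_enum _).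
  by move/eqP; rewrite gt_eqF// l2norm_gt0// eq_sym.
by apply: big1 => j _; rewrite perm1 subrr l2norm0.
Qed.

Lemma perm_size_le s : perm_size s Y <= config_size Y.
Proof. exact: le_bigmax. Qed.

Lemma perm_size_max : exists s, perm_size s Y = config_size Y.
Proof.
pose s0 := [arg max_(s > 1%g : 'S_N) perm_size s Y]%O.
exists s0; apply/eqP; rewrite eq_le perm_size_le /=.
apply: bigmax_le => [|s _]; first exact: perm_size_ge0.
by rewrite /s0; case: Order.TotalTheory.arg_maxP => // t _ /(_ s isT).
Qed.

Lemma top_res_poly : generic_config Y ->
  \sum_(s | perm_size s Y == config_size Y) res_poly s != 0.
Proof.
move=> gY; have [s0 s0V] := perm_size_max.
pose U := (-1) ^+ s0 *: \prod_j fix_poly s0 j.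
(* All maximal permutations share the polynomial [U], so the top coefficient is [U] times a sum of
   positive weights. *)
have -> : \sum_(s | perm_size s Y == config_size Y) res_poly s =
    (\sum_(s | perm_size s Y == config_size Y) weight s)%:C *: U.
  rewrite rmorph_sum scaler_suml; apply: eq_bigr => s /eqP sV.
  have E i j : i != j -> edge s i j = edge s0 i j.
    move=> ij; apply/eqP; apply: contraT => ne.
    have : edges_differ s s0 by apply/existsP; exists i; apply/existsP; exists j; rewrite ij.
    by move=> /gY; rewrite sV s0V eqxx.
  rewrite /res_poly (edge_odd E); congr (_ *: (_ *: _)).
  apply: eq_bigr => j _; rewrite /fix_poly.
  have -> // : (s j == j) = (s0 j == j).
  apply/eqP/eqP; apply: edge_fix => k jk; rewrite E//.
rewrite scaler_eq0 negb_or signed_prod_neq0 andbT.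
rewrite -nrm_gt0 nrmC normr_gt0 gt_eqF// (bigD1 s0) ?s0V//=.
by rewrite ltr_pwDl ?weight_gt0// sumr_ge0// => s _; rewrite ltW// weight_gt0.
Qed.

End ResonancePolynomial.

Theorem theorem1p1 (R : realType) (N : nat) (hN : (2 <= N)%N) :
  exists A1 : set (config R N),
    [/\ open A1, dense A1 &
      forall (Y : config R N) (a : 'I_N -> R[i]), A1 Y ->
        exists C : R, \forall r \near +oo,
          (`| resonance_count a Y r - (config_size Y / pi * r)%:E | <= C%:E)%E].
Proof.
have [oG dG] := @open_dense_generic R N.
exists generic_config; split=> // Y a gY.
have := expoly_disc_count (perm_size_ge0 Y) (perm_size_le Y)
  (bottom_res_poly a Y) (top_res_poly a gY).
rewrite /resonance_count /resonance_mult /zero_count.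
suff -> : (fun z => \det (Gamma a Y z)) =
  expoly (res_poly a Y) (fun s => perm_size s Y) by [].
by apply/funext => z; rewrite det_Gamma.
Qed.
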